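(* Let $T=\{2413,2431,3214\}$. Then $$F_T(x)=\frac{1-5x+7x^2-4x^3}{1-6x+11x^2-9x^3+2x^4}.$$
   Context: $S_n(T)$ denotes the set of permutations $\pi$ of $[n]=\{1,\dots,n\}$ (one-line notation) that avoid every pattern $\tau\in T$, i.e. no subsequence of $\pi$ is order-isomorphic to $\tau$. $F_T(x)=\sum_{n\ge 0}|S_n(T)|x^n$, a formal power series, with $|S_0(T)|=1$. *)

(* Defs.v *)
From HB Require Import structures.
From mathcomp Require Import all_boot all_order all_fingroup all_algebra.

Set Implicit Arguments.
Unset Strict Implicit.
Unset Printing Implicit Defensive.

Import GRing.Theory.
Local Open Scope ring_scope.

Definition one_line (n : nat) (pi : 'S_n) : seq nat :=
  [seq (pi i).+1 | i <- enum 'I_n].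

Definition order_iso (s t : seq nat) : bool :=
  (size s == size t) &&
  [forall i : 'I_(size s), forall j : 'I_(size s),
     (nth 0 s i < nth 0 s j)%N == (nth 0 t i < nth 0 t j)%N].

(* Subsequences are enumerated as masks so that containment is a boolean;
   containsP is the version with an arbitrary subsequence. *)
Definition contains (w tau : seq nat) : bool :=
  [exists m : (size w).-tuple bool, order_iso (mask m w) tau].

Lemma containsP (w tau : seq nat) :
  reflect (exists2 s, subseq s w & order_iso s tau) (contains w tau).
Proof.
apply: (iffP existsP) => [[m iso_m] | [s /subseqP[m size_m ->] iso_s]].
  by exists (mask m w) => //; apply: mask_subseq.
by exists (Tuple (introT eqP size_m)).
Qed.

(* Patterns are given in one-line notation, with letters 1, ..., k. *)
Definition avoiders (n : nat) (T : seq (seq nat)) : {set 'S_n} :=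
  [set pi : 'S_n | all (fun tau => ~~ contains (one_line pi) tau) T].

(* A formal power series is its sequence of coefficients; equality of series
   is the extensional =1. *)
Definition fps (R : Type) : Type := nat -> R.

Section FormalPowerSeries.
Variable R : comUnitRingType.
Implicit Types (f g q : fps R) (p : {poly R}).

Definition fps_of_poly p : fps R := fun n => p`_n.

Definition fps_mul f g : fps R := fun n => \sum_(i < n.+1) f i * g (n - i)%N.

(* Long division: the first n coefficients of f / g, for g 0 a unit. *)
Fixpoint fps_div_prefix f g (n : nat) : seq R :=
  if n is m.+1 then
    let s := fps_div_prefix f g m in
    rcons s ((f m - \sum_(i < m) s`_i * g (m - i)%N) / g 0%N)
  else [::].

Definition fps_div f g : fps R := fun n => (fps_div_prefix f g n.+1)`_n.

Lemma size_fps_div_prefix f g n : size (fps_div_prefix f g n) = n.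
Proof. by elim: n => //= n IHn; rewrite size_rcons IHn. Qed.

Lemma nth_fps_div_prefix f g n i :
  (i < n)%N -> (fps_div_prefix f g n)`_i = fps_div f g i.
Proof.
elim: n => // n IHn; rewrite ltnS leq_eqVlt => /predU1P[-> // | lt_i_n].
by rewrite /= nth_rcons size_fps_div_prefix lt_i_n IHn.
Qed.

Lemma fps_divE f g n :
  fps_div f g n = (f n - \sum_(i < n) fps_div f g i * g (n - i)%N) / g 0%N.
Proof.
rewrite {1}/fps_div /= nth_rcons size_fps_div_prefix ltnn eqxx.
by under eq_bigr => i _ do rewrite nth_fps_div_prefix //.
Qed.

Lemma fps_divP f g q :
  g 0%N \is a GRing.unit -> (q =1 fps_div f g) <-> (fps_mul q g =1 f).
Proof.
move=> g0U; split=> [eq_q n | eq_f].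
  rewrite /fps_mul big_ord_recr /= subnn (eq_q n) fps_divE divrK //.
  by under eq_bigr => i _ do rewrite eq_q; rewrite addrC subrK.
elim/ltn_ind=> n IHn; rewrite fps_divE -(eq_f n) /fps_mul big_ord_recr /= subnn.
under [X in _ - X]eq_bigr => i _ do rewrite -IHn //.
by rewrite addrAC subrr add0r mulrK.
Qed.

End FormalPowerSeries.

Definition avoiders_gf (T : seq (seq nat)) : fps rat :=
  fun n => #|avoiders n T|%:R.

(* Main.v *)
(* Write a nonempty avoider as alpha n beta with n its largest letter. If beta is
   empty, the only condition is that alpha avoids A = {321, 2413}. Otherwise
   2413 and 2431 force every letter of alpha to lie below all of beta or above
   all of beta. Let sigma be the part of alpha before its first high letter: it
   avoids A and lies below the rest of the word. What follows is a shuffle of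
   increasing low letters and an increasing run of high letters (starting with
   a high letter), then an increasing block of s high letters below that run,
   then an increasing block of t letters above it (t = 0 if s = 0). These data
   are free and beta is an arbitrary nonempty avoider, so
     F = 1 + x (A + A E (F - 1)),  E = 1 + x / (1 - 2x) (1 + x / (1 - x)^2).
   The avoiders of A are the same words with s = t = 0 and beta increasing, so
     A = 1 + x (A + A (1 + x / (1 - 2x)) x / (1 - x)).
   Eliminating A gives F. *)

Require Import Defs.
From mathcomp Require Import all_boot all_order all_fingroup all_algebra.
From mathcomp Require Import zify ring.
Import GRing.Theory.

Set Implicit Arguments.
Unset Strict Implicit.
Unset Printing Implicit Defensive.

(** * Subsequences of concatenations and pairwise relations *)

(** The cut is an index into [s], so that for an explicit [s] a case analysis on [i] computes both
    pieces. *)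
Lemma subseq_cat_split (T : eqType) (s u v : seq T) :
  subseq s (u ++ v) ->
  exists2 i, i <= size s & subseq (take i s) u && subseq (drop i s) v.
Proof.
case/subseqP=> m size_m ->.
rewrite -(cat_take_drop (size u) m) mask_cat; last first.
  by rewrite size_take size_m size_cat; case: ltnP; lia.
exists (size (mask (take (size u) m) u)); first by rewrite size_cat leq_addr.
by rewrite take_size_cat // drop_size_cat // !mask_subseq.
Qed.

Lemma pairwiseP2 (T : eqType) (r : rel T) (s : seq T) :
  (forall x y, subseq [:: x; y] s -> r x y) <-> pairwise r s.
Proof.
split; elim: s => [|z s IHs] //=.
  move=> r_s; apply/andP; split.
    by apply/allP=> y s_y; apply: r_s; rewrite /= eqxx sub1seq.
  by apply: IHs => x y sub_xy; apply: r_s; apply: subseq_trans sub_xy (subseq_cons _ _).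
case/andP=> /allP r_z /IHs{}IHs x y; case: eqP => [-> | _].
  by rewrite sub1seq => /r_z.
exact: IHs.
Qed.

Lemma subseq_mem_all (T : eqType) (s u : seq T) :
  subseq s u -> all [in u] s.
Proof. by move=> /mem_subseq sub; apply/allP. Qed.

(** * Avoidance of the patterns as inequalities between letters *)

Definition avoids321 (w : seq nat) :=
  forall a b c, subseq [:: a; b; c] w -> ~~ ((c < b) && (b < a)).

Definition avoids2413 (w : seq nat) :=
  forall a b c d, subseq [:: a; b; c; d] w -> ~~ [&& c < a, a < d & d < b].

Definition avoids2431 (w : seq nat) :=
  forall a b c d, subseq [:: a; b; c; d] w -> ~~ [&& d < a, a < c & c < b].

Definition avoids3214 (w : seq nat) :=
  forall a b c d, subseq [:: a; b; c; d] w -> ~~ [&& c < b, b < a & a < d].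

Definition avA w := avoids321 w /\ avoids2413 w.
Definition avF w := [/\ avoids2413 w, avoids2431 w & avoids3214 w].

Lemma avF_sub u w : subseq u w -> avF w -> avF u.
Proof.
move=> sub [w1 w2 w3].
by split=> a b c d s; [apply: w1 | apply: w2 | apply: w3]; apply: subseq_trans sub.
Qed.

Lemma avA_sub u w : subseq u w -> avA w -> avA u.
Proof.
move=> sub [w1 w2].
by split=> [a b c s|a b c d s]; [apply: w1 | apply: w2]; apply: subseq_trans sub.
Qed.

(** Both 2431 and 3214 contain 321: the last three letters of the former, the first three of the
    latter. *)
Lemma avA_avF w : avA w -> avF w.
Proof.
case=> w1 w2; split=> // a b c d s.
  have /w1 : subseq [:: b; c; d] w by apply: subseq_trans (subseq_cons _ _) s.
  by lia.
have /w1 : subseq [:: a; b; c] w.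
  by apply: subseq_trans s; rewrite /= !eqxx.
by lia.
Qed.

(** An occurrence that meets both words splits its pattern into a lower part followed by an upper
    part. Of the three patterns only 3214 splits so, as 321 followed by 4, and [u] avoids 321. *)
Lemma avF_cat u v : avA u -> avF v -> {in u & v, forall x y, x < y} ->
  avF (u ++ v).
Proof.
move=> avu avv uv; case: (avA_avF avu) (avu) avv => u1 u2 u3 [u4 _] [v1 v2 v3].
split=> a b c d /subseq_cat_split [[|[|[|[|[|i]]]]]] //= _ /andP[su sv];
  move: (subseq_mem_all su) (subseq_mem_all sv) => /= mu mv;
  try (by move: (u1 _ _ _ _ su)); try (by move: (u2 _ _ _ _ su));
  try (by move: (u3 _ _ _ _ su));
  try (by move: (v1 _ _ _ _ sv)); try (by move: (v2 _ _ _ _ sv));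
  try (by move: (v3 _ _ _ _ sv));
  try (move: (u4 _ _ _ su));
  repeat match goal with H : is_true (_ && _) |- _ => case/andP: H => ? ? end;
  repeat match goal with H : is_true (?x \in u), H' : is_true (?y \in v) |- _ =>
     lazymatch goal with _ : is_true (x < y) |- _ => fail | _ => have ? := uv _ _ H H' end end; lia.
Qed.

Lemma avoids321_cat u v : avoids321 u -> avoids321 v ->
  {in u & v, forall x y, x < y} -> avoids321 (u ++ v).
Proof.
move=> u1 v1 uv a b c /subseq_cat_split [[|[|[|[|i]]]]] //= _ /andP[su sv];
  move: (subseq_mem_all su) (subseq_mem_all sv) => /= mu mv;
  try (by move: (u1 _ _ _ su));
  try (by move: (v1 _ _ _ sv));
  repeat match goal with H : is_true (_ && _) |- _ => case/andP: H => ? ? end;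
  repeat match goal with H : is_true (?x \in u), H' : is_true (?y \in v) |- _ =>
     lazymatch goal with _ : is_true (x < y) |- _ => fail | _ => have ? := uv _ _ H H' end end; lia.
Qed.

Lemma avoids321_cons x v : avoids321 v ->
  pairwise (fun y z => (y < x) && (z < x) ==> (y < z)) v -> avoids321 (x :: v).
Proof.
move=> v1 /pairwiseP2 v2 a b c /=; case: eqP => [-> /v2 | _ /v1 //].
by lia.
Qed.

(* Violated on the larger letters when [x] is the 2 of a 2413 or 2431, and on the
   smaller letters when [x] is the 3 of a 3214. *)
Definition layer x : rel nat :=
  fun y z => (y < x) && (z < x) || (x < y) && (x < z) ==> (y < z).

(** A new occurrence starts with [x]. As the 2 of 2413 or 2431 it needs a descent among the larger
    letters ([pair]), but these are increasing letters of [v] and then [n]. As the 3 of 3214 it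
    needs a descent of smaller letters before a larger one ([triple]); that larger one is in [v] or
    is [n], so the descent lies in [v]. *)
Lemma avF_cons x v n s : avF (v ++ n :: s) -> pairwise (layer x) v ->
  {in v, forall y, y < n} -> {in s, forall y, y < x} -> x < n ->
  avF (x :: v ++ n :: s).
Proof.
case=> v1 v2 v3 /pairwiseP2 lay vn sx xn.
have tl y t : subseq (y :: t) (n :: s) -> subseq t s.
  by rewrite /=; case: eqP => // _ /(subseq_trans (subseq_cons _ _)).
have n_max y : y \in n :: s -> x < y -> y = n.
  by rewrite inE => /predU1P[-> // | /sx]; lia.
(* From here on the suffix is known only through [tl] and [n_max]. *)
move: (n :: s) tl n_max v1 v2 v3 => u tl n_max v1 v2 v3.
have pair b d : subseq [:: b; d] (v ++ u) -> x < d -> b <= d.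
  case/subseq_cat_split => [[|[|[|i]]]] //= _ /andP[].
  - by move=> _ /tl; rewrite sub1seq => /sx; lia.
  - by rewrite !sub1seq => /vn bn /n_max; lia.
  - by move/lay; rewrite /layer; lia.
have triple b c d : subseq [:: b; c; d] (v ++ u) -> x < d -> b < x -> c < x ->
    b <= c.
  case/subseq_cat_split => [[|[|[|[|i]]]]] //= _ /andP[].
  - by move=> _ /tl /subseq_mem_all /= /and3P[_ /sx]; lia.
  - by move=> _ /tl /subseq_mem_all /= /andP[/sx]; lia.
  - by move/lay; rewrite /layer; lia.
  - move=> /(subseq_trans (subseq_rcons [:: b; c] d)) /lay; rewrite /layer; lia.
split=> a b c d /=; (case: (eqVneq a x) => [-> {a} | _];
   [ | by [apply: v1 | apply: v2 | apply: v3 ]]) => sub.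
- have sub_bd : subseq [:: b; d] [:: b; c; d].
    by rewrite (@cat_subseq _ [:: b] _ [:: b]) ?subseq_cons.
  by have := pair b d (subseq_trans sub_bd sub); lia.
- by have := pair b c (subseq_trans (subseq_rcons [:: b; c] d) sub); lia.
- by have := triple _ _ _ sub; lia.
Qed.

(** None of the three patterns begins with its largest letter. *)
Lemma avF_max n s : avF s -> {in s, forall y, y < n} -> avF (n :: s).
Proof.
move=> [s1 s2 s3] sn; split=> a b c d /=;
  (case: (eqVneq a n) => [-> {a} | _];
   [ | by [apply: s1 | apply: s2 | apply: s3 ]])
  => /subseq_mem_all /= /and4P[/sn ? /sn ? /sn ? _]; lia.
Qed.

(** The alternatives are the two ways of putting a letter in front while preserving [avF]: by
    [avF_cat] with a one-letter word, or by [avF_cons]. *)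
Fixpoint layered (s tau : seq nat) : bool :=
  if tau is x :: v then
    (all (ltn x) (v ++ s) || all (gtn x) s && pairwise (layer x) v) && layered s v
  else true.

Lemma avF_layered tau n s : avF s -> {in tau ++ s, forall y, y < n} ->
  layered s tau -> avF (tau ++ n :: s).
Proof.
move=> avs; elim: tau => [|x v IHv] /=.
  by move=> sn _; apply: avF_max.
move=> vn /andP[x_lay lay].
have xn : x < n by apply: vn; rewrite mem_head.
have vn' : {in v ++ s, forall y, y < n} by move=> y y_v; apply: vn; rewrite inE y_v orbT.
have {}IHv := IHv vn' lay.
case/orP: x_lay => [/allP xlt | /andP[/allP sx pw]].
  apply: (@avF_cat [:: x]) => //.
    by split=> a b c => [|d] /size_subseq.
  move=> y z; rewrite inE => /eqP->; rewrite mem_cat inE => /or3P[z_v | /eqP-> // | z_s].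
    by apply: xlt; rewrite mem_cat z_v.
  by apply: xlt; rewrite mem_cat z_s orbT.
apply: avF_cons => //.
by move=> y y_v; apply: vn'; rewrite mem_cat y_v.
Qed.

(** * Shuffles of two increasing runs, encoded by bit words *)

Fixpoint weave (b : seq bool) (lo hi : nat) : seq nat :=
  if b is x :: b' then
    if x then hi :: weave b' lo hi.+1 else lo :: weave b' lo.+1 hi
  else [::].

Lemma size_weave b lo hi : size (weave b lo hi) = size b.
Proof. by elim: b lo hi => //= -[] b IHb lo hi /=; rewrite IHb. Qed.

Lemma perm_weave b lo hi :
  perm_eq (weave b lo hi) (iota lo (count negb b) ++ iota hi (count id b)).
Proof.
elim: b lo hi => // -[] b IHb lo hi; last by rewrite [weave _ _ _]/= perm_cons IHb.
rewrite [count id _]/= [count negb _]/= -[iota hi _]/([:: hi] ++ iota hi.+1 (count id b)) perm_sym perm_catCA /= perm_cons perm_sym.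
exact: IHb.
Qed.

Lemma mem_weave b lo hi y : (y \in weave b lo hi) =
  (lo <= y < lo + count negb b) || (hi <= y < hi + count id b).
Proof. by rewrite (perm_mem (perm_weave b lo hi)) mem_cat !mem_iota. Qed.

Lemma map_weave b lo hi c : lo + count negb b <= c <= hi ->
  [seq c <= y | y <- weave b lo hi] = b.
Proof. by elim: b lo hi => //= -[] b IHb lo hi /= c_b; (congr (_ :: _); [lia | apply: IHb; lia]). Qed.

(** With [map_weave], this makes comparison with a threshold between the two runs the inverse of
    [weave]. *)
Lemma weaveK (s : seq nat) c lo k hi r :
  [seq y <- s | y < c] = iota lo k -> [seq y <- s | c <= y] = iota hi r ->
  weave [seq c <= y | y <- s] lo hi = s.
Proof.
elim: s lo k hi r => //= x s IHs lo k hi r; case: ltnP => cx.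
  by case: k => // k [-> lo_s] hi_s; congr (_ :: _); apply: IHs lo_s hi_s.
by case: r => [|r] lo_s //= [-> hi_s]; congr (_ :: _); apply: IHs lo_s hi_s.
Qed.

Lemma pairwise_ltn_iota i n : pairwise ltn (iota i n).
Proof. by rewrite -sorted_pairwise ?iota_ltn_sorted //; apply: ltn_trans. Qed.

Section Tau.
Variables (x s0 s t0 t : nat).

(** Below [x] come the low letters and then block [s]; above [x] come the high letters and then
    block [t]. Each of the two lists is increasing. *)
Lemma pairwise_layer b lo hi : lo + count negb b <= x < hi ->
  lo + count negb b <= s0 -> s0 + s <= x -> hi + count id b <= t0 ->
  pairwise (layer x) (weave b lo hi ++ iota s0 s ++ iota t0 t).
Proof.
elim: b lo hi => /= [|y b IHb] lo hi.
  move=> x_lo lo_s s_x hi_t; rewrite pairwise_cat.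
  rewrite !(sub_pairwise _ (pairwise_ltn_iota _ _)); last first.
  - by move=> y z; rewrite /layer; lia.
  - by move=> y z; rewrite /layer; lia.
  rewrite !andbT; apply/allrelP=> y z; rewrite !mem_iota /layer; lia.
case: y => /= x_lo lo_s s_x hi_t; rewrite IHb ?andbT; try lia;
  apply/allP=> z; rewrite !mem_cat mem_weave !mem_iota /layer; lia.
Qed.

End Tau.

Lemma layered_sorted beta u : pairwise ltn u ->
  {in beta & u, forall y x, y < x} -> layered beta u.
Proof.
elim: u => //= x u IHu /andP[_ ltn_u] lt_u; apply/andP; split; last first.
  by apply: IHu => // y z y_b z_u; apply: lt_u; rewrite // inE z_u orbT.
apply/orP; right; apply/andP; split.
  by apply/allP=> y y_b; apply: lt_u; rewrite ?mem_head.
by apply: sub_pairwise ltn_u => y z /= yz; rewrite /layer yz implybT.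
Qed.

(** Low letters satisfy the first alternative of [layered]; high letters and those of the two blocks
    satisfy the second. *)
Lemma layered_weave beta b lo hi s0 s t0 t :
  {in beta, forall y, lo + count negb b <= y < s0} ->
  lo + count negb b <= s0 -> s0 + s <= hi -> hi + count id b <= t0 ->
  layered beta (weave b lo hi ++ iota s0 s ++ iota t0 t).
Proof.
elim: b lo hi => [|[] b IHb] lo hi /= beta_in lo_s s_hi hi_t.
- apply: layered_sorted; last first.
    by move=> y z /beta_in; rewrite mem_cat !mem_iota; lia.
  rewrite pairwise_cat !pairwise_ltn_iota !andbT.
  by apply/allrelP=> y z; rewrite !mem_iota /=; lia.
- rewrite IHb ?andbT; try lia; first last.
    by move=> y /beta_in; lia.
  rewrite pairwise_layer ?andbT; try lia.
  by apply/orP; right; apply/allP=> y /beta_in /=; lia.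
rewrite IHb ?andbT; try lia; first last.
  by move=> y /beta_in; lia.
apply/orP; left; apply/allP=> y.
rewrite !mem_cat !mem_iota mem_weave -!orbA => /or4P[|||]; try (rewrite /=; lia).
by case/orP=> [|/beta_in] /=; lia.
Qed.

Lemma avoids321_sorted u : pairwise ltn u -> avoids321 u.
Proof.
move/pairwiseP2=> lt_u a b c sub.
by have := lt_u _ _ (subseq_trans (subseq_rcons [:: a; b] c) sub); rewrite /=; lia.
Qed.

(** Smaller letters after a high letter are the remaining low ones and then the run from [c], in
    increasing order; no smaller letter follows a low one. *)
Lemma avoids321_weave b lo hi n c m : lo + count negb b <= c -> c + m <= hi ->
  hi + count id b <= n -> avoids321 (weave b lo hi ++ n :: iota c m).
Proof.
pose below x : rel nat := fun y z => (y < x) && (z < x) ==> (y < z).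
have pw x d d' h : d + count negb d' <= c -> c + m <= x <= h ->
    h + count id d' <= n ->
    pairwise (below x) (weave d' d h ++ n :: iota c m).
  elim: d' d h => [|[] d' IHd] d h /= d_c xh hn.
  - apply/andP; split; first by apply/allP=> y; rewrite mem_iota /below; lia.
    by apply: sub_pairwise (pairwise_ltn_iota _ _) => y z /= yz; rewrite /below yz implybT.
  - rewrite IHd ?andbT; try lia.
    by apply/allP=> y _; rewrite /below; lia.
  - rewrite IHd ?andbT; try lia.
    by apply/allP=> y; rewrite mem_cat inE mem_weave mem_iota /below; lia.
elim: b lo hi => [|[] b IHb] lo hi /= lo_c c_hi hi_n; apply: avoids321_cons.
- by apply: avoids321_sorted; apply: pairwise_ltn_iota.
- by apply: sub_pairwise (pairwise_ltn_iota _ _) => y z /= ->; rewrite implybT.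
- by apply: IHb; lia.
- by apply: pw; lia.
- by apply: IHb; lia.
apply/pairwiseP2=> y z /subseq_mem_all /= /and3P[+ _ _].
by rewrite mem_cat inE mem_weave mem_iota; lia.
Qed.

(* The letters increase through the blocks sigma, low letters of the shuffle, beta,
   block [s], high letters of the shuffle, block [t], largest letter. *)
Definition build (sigma : seq nat) (b : seq bool) (s t : nat) (beta : seq nat) :=
  let c := size sigma + count negb b in
  let h := c + size beta + s in
  sigma ++
  (weave b (size sigma) h ++ iota (c + size beta) s ++ iota (h + count id b) t) ++
  (h + count id b + t) :: [seq c + y | y <- beta].

(** * Assembled words are avoiding permutations *)

Definition permA w := perm_eq w (iota 0 (size w)) /\ avA w.
Definition permF w := perm_eq w (iota 0 (size w)) /\ avF w.

Lemma perm_shift c (s : seq nat) : perm_eq s (iota 0 (size s)) ->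
  perm_eq [seq c + y | y <- s] (iota c (size s)).
Proof. by move/(perm_map (addn c)); rewrite -iotaDl addn0. Qed.

Lemma count_negb_id b : count negb b + count id b = size b.
Proof. by elim: b => // -[] b /= <-; lia. Qed.

Lemma size_build sigma b s t beta : size (build sigma b s t beta) =
  (size sigma + (size b + (s + t) + size beta)).+1.
Proof. by rewrite /build !(size_cat, size_weave, size_iota, size_map) /= size_map; lia. Qed.

Lemma build_perm (sigma : seq nat) b s t (beta : seq nat) : perm_eq sigma (iota 0 (size sigma)) ->
  perm_eq beta (iota 0 (size beta)) ->
  perm_eq (build sigma b s t beta) (iota 0 (size (build sigma b s t beta))).
Proof.
move=> perm_s perm_b; apply/seq.permP=> a.
have -> : size (build sigma b s t beta) =
    size sigma + count negb b + size beta + s + count id b + t + 1.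
  by rewrite size_build -(count_negb_id b); lia.
rewrite !iotaD !add0n !count_cat (seq.permP (perm_weave _ _ _)) /= (seq.permP perm_s).
rewrite (seq.permP (perm_shift _ perm_b)) count_cat; ring.
Qed.

Lemma mem_shift c (s : seq nat) y : perm_eq s (iota 0 (size s)) ->
  (y \in [seq c + z | z <- s]) = (c <= y < c + size s).
Proof. by move=> perm_s; rewrite (perm_mem (perm_shift c perm_s)) mem_iota. Qed.

Lemma subseq_map_inv (f : nat -> nat) (u s : seq nat) : subseq u (map f s) ->
  exists2 v, subseq v s & u = map f v.
Proof.
case/subseqP=> m size_m ->; exists (mask m s); last by rewrite map_mask.
exact: mask_subseq.
Qed.

Lemma avF_map c s : avF s <-> avF [seq c + y | y <- s].
Proof.
split=> -[s1 s2 s3]; split=> a b e d sub.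
- by case: (subseq_map_inv sub) => -[|? [|? [|? [|? [|? ?]]]]] // /s1 + [-> -> -> ->]; lia.
- by case: (subseq_map_inv sub) => -[|? [|? [|? [|? [|? ?]]]]] // /s2 + [-> -> -> ->]; lia.
- by case: (subseq_map_inv sub) => -[|? [|? [|? [|? [|? ?]]]]] // /s3 + [-> -> -> ->]; lia.
- by have := s1 _ _ _ _ (map_subseq (addn c) sub); lia.
- by have := s2 _ _ _ _ (map_subseq (addn c) sub); lia.
- by have := s3 _ _ _ _ (map_subseq (addn c) sub); lia.
Qed.

Lemma build_avF (sigma : seq nat) b s t (beta : seq nat) : permA sigma -> permF beta ->
  avF (build sigma b s t beta).
Proof.
move=> [perm_s avs] [perm_b avb]; apply: avF_cat => //.
  apply: avF_layered.
- by case: (avF_map (size sigma + count negb b) beta) => /(_ avb).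
- move=> y; rewrite !mem_cat mem_weave !mem_iota mem_shift //; lia.
- apply: layered_weave; try lia.
  by move=> y; rewrite mem_shift.
move=> x y; rewrite (perm_mem perm_s) !mem_cat inE mem_weave !mem_iota mem_shift //.
by move: (size sigma) (size beta) (count _ _) (count _ _) => i m k r; lia.
Qed.

Lemma avF_rcons n s : avA s -> {in s, forall y, y < n} -> avF (rcons s n).
Proof.
move=> avs sn; rewrite -cats1; apply: avF_cat => //.
  by split=> a b c d /size_subseq.
by move=> x y xs; rewrite inE => /eqP->; apply: sn.
Qed.

Lemma avA_sorted u : pairwise ltn u -> avA u.
Proof.
move=> lt_u; split; first exact: avoids321_sorted.
move: lt_u => /pairwiseP2 lt_u a b c d sub.
have sub_bc : subseq [:: b; c] [:: a; b; c; d].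
  exact: subseq_trans (subseq_rcons [:: b; c] d) (subseq_cons _ _).
by have := lt_u _ _ (subseq_trans sub_bc sub); rewrite /=; lia.
Qed.

(** Only 321 needs a direct argument; 2413 is covered by [build_avF], an increasing word being in
    [permF]. *)
Lemma build_avA (sigma : seq nat) b m : permA sigma ->
  avA (build sigma b 0 0 (iota 0 m)).
Proof.
move=> permA_s; split.
  case: permA_s => perm_s [avs _].
  rewrite /build !cats0 size_iota -iotaDl addn0; apply: avoids321_cat => //.
    by apply: avoids321_weave; rewrite ?addn0.
  move=> x y; rewrite (perm_mem perm_s) !mem_cat inE mem_weave !mem_iota.
  by move: (size sigma) (count _ _) (count _ _) => i k r; lia.
have permF_iota : permF (iota 0 m).
  by split; [rewrite size_iota | apply/avA_avF/avA_sorted/pairwise_ltn_iota].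
by case: (build_avF b 0 0 permA_s permF_iota).
Qed.

(** * Prefixes, minima and filters of sequences *)

Lemma span_seq (T : Type) (p : pred T) (s : seq T) :
  exists u v, [/\ s = u ++ v, all p u & if v is x :: _ then ~~ p x else true].
Proof.
elim: s => [|x s [u [v [-> pu pv]]]]; first by exists [::], [::].
case px: (p x); first by exists (x :: u), v; rewrite /= px.
by exists [::], (x :: u ++ v); rewrite /= px.
Qed.

Lemma seq_min (s : seq nat) : s <> [::] ->
  exists2 c, c \in s & {in s, forall y, c <= y}.
Proof.
elim: s => // x [_ _|y s /(_ _)[] // c c_s c_min].
  by exists x => [|z]; rewrite inE ?eqxx // => /eqP->.
case: (leqP x c) => xc.
  exists x => [|z]; first by rewrite mem_head.
  by rewrite inE => /predU1P[->|/c_min]; lia.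
exists c => [|z]; first by rewrite inE c_s orbT.
by rewrite inE => /predU1P[->|/c_min]; lia.
Qed.

Lemma subseq_pair (T : eqType) (s : seq T) x y : x \in s -> y \in s -> x != y ->
  subseq [:: x; y] s || subseq [:: y; x] s.
Proof.
elim: s => // z s IHs; rewrite !inE.
have [<-|xz] := eqVneq x z; first by rewrite eq_sym /= => _ /predU1P[->|]; rewrite ?eqxx ?sub1seq // => ->.
have [<-|yz] := eqVneq y z; first by move=> /= xs _ _; rewrite eqxx sub1seq xs orbT.
by rewrite /= (negPf xz) (negPf yz); apply: IHs.
Qed.

Lemma subseq_uniq_pair (T : eqType) (s : seq T) x y :
  uniq s -> subseq [:: x; y] s -> x != y.
Proof. by move=> uniq_s /subseq_uniq/(_ uniq_s); rewrite /= inE andbT. Qed.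

Lemma cat_filter (T : eqType) (p : pred T) (s : seq T) :
  (forall x y, subseq [:: x; y] s -> p y -> p x) ->
  s = [seq x <- s | p x] ++ [seq x <- s | ~~ p x].
Proof.
elim: s => //= x s IHs p_s; have {}IHs := IHs (fun y z yz => p_s y z (subseq_trans yz (subseq_cons _ _))).
case px: (p x) => /=; first by rewrite -IHs.
have -> : [seq y <- s | p y] = [::].
  apply/eqP; rewrite -[_ == _]negbK -has_filter; apply/hasPn => y ys.
  by apply/negP => /(p_s x y); rewrite /= eqxx sub1seq px => /(_ ys).
rewrite /=; congr cons; rewrite {1}IHs.
have -> // : [seq y <- s | p y] = [::].
apply/eqP; rewrite -[_ == _]negbK -has_filter; apply/hasPn => y ys.
by apply/negP => /(p_s x y); rewrite /= eqxx sub1seq px => /(_ ys).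
Qed.

Lemma pairwise_filterP (T : eqType) (r : rel T) (p : pred T) (s : seq T) :
  (forall x y, subseq [:: x; y] s -> p x -> p y -> r x y) ->
  pairwise r [seq x <- s | p x].
Proof.
move=> r_s; apply/pairwiseP2 => x y sub.
have := subseq_mem_all sub; rewrite /= !mem_filter => /and3P[/andP[px _] /andP[py _] _].
by apply: r_s => //; apply: subseq_trans sub (filter_subseq _ _).
Qed.

(** * The shape of an avoider *)

Section Shape.
(** Here [c] is the least letter of [beta] and [h] is the first letter of the word that is at least
    [c]. Letters before [n] are low if below [c]; otherwise they are high, hence above all of
    [beta]. *)
Variables (n : nat) (sigma : seq nat) (h : nat) (tau beta : seq nat) (c : nat).
Let w := sigma ++ (h :: tau) ++ n :: beta.
Hypotheses (av : avF w) (uniq_w : uniq w).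
Hypotheses (max_n : {in sigma ++ (h :: tau) ++ beta, forall y, y < n}).
Hypotheses (c_beta : c \in beta) (c_min : {in beta, forall y, c <= y}).
Hypotheses (sigma_c : {in sigma, forall y, y < c}) (c_h : c <= h).
Hypothesis beta_interval : {in h :: tau & beta, forall x y, c <= x -> y < x}.

Lemma shape_subseq u v x : subseq u sigma -> subseq v tau -> x \in n :: beta ->
  subseq (u ++ h :: v ++ [:: x]) w.
Proof.
move=> su sv xb; apply: cat_subseq su _; rewrite (@cat_subseq _ (h :: v)) ?sub1seq //.
by rewrite /= eqxx.
Qed.

Lemma shape_neq x y : subseq [:: x; y] tau -> [/\ x != y, x != h & y != h].
Proof.
move=> sub; have /(subseq_uniq)/(_ uniq_w) := shape_subseq (sub0seq _) sub (mem_head n beta).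
rewrite /= !inE !negb_or => /and3P[/and3P[hx hy _] /andP[xy _] _].
by split; rewrite // eq_sym.
Qed.

(** A descent below [h] gives a 3214 that starts with [h] and ends with [n]; a descent above [h]
    gives a 2431 that starts with [h] and ends with [c]. *)
Lemma shape_layer : pairwise (layer h) tau.
Proof.
apply/pairwiseP2=> x y sub; case: av => _ av2 av3; have [xy xh yh] := shape_neq sub.
have hn : h < n by apply: max_n; rewrite mem_cat mem_head orbT.
have := av3 _ _ _ _ (shape_subseq (sub0seq _) sub (mem_head n beta)).
have c_nb : c \in n :: beta by rewrite inE c_beta orbT.
have := av2 _ _ _ _ (shape_subseq (sub0seq _) sub c_nb).
have ch : c != h.
  have /(subseq_uniq)/(_ uniq_w) := shape_subseq (sub0seq _) (sub0seq _) c_nb.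
  by rewrite /= inE eq_sym andbT.
by rewrite /layer; lia.
Qed.

(** If [y] is low and [y < x], then [x h y c] is a 2413. *)
Lemma shape_sigma_low : {in sigma & tau, forall x y, x < y}.
Proof.
move=> x y xs ys; case: (leqP c y) => cy; first by have := sigma_c xs; lia.
have c_nb : c \in n :: beta by rewrite inE c_beta orbT.
have sub : subseq [:: x; h; y; c] w.
  by apply: (@shape_subseq [:: x] [:: y]) => //; rewrite sub1seq.
have := subseq_uniq sub uniq_w; rewrite /= !inE.
by case: av => /(_ _ _ _ _ sub) + _ _; have := sigma_c xs; lia.
Qed.

(** The shuffle is [h :: u]; it ends just before the first letter of [tau] in the interval from [c]
    to [h]. [S] and [T] are the two increasing blocks after it. *)
Lemma shape_tail : exists u S T,
  [/\ tau = u ++ S ++ T, (S = [::] -> T = [::]),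
      all (fun y => ~~ (c <= y < h)) u,
      all (fun y => c <= y < h) S & all (leq h) T].
Proof.
have [u [v [def_tau small_u v_head]]] := span_seq (fun y => ~~ (c <= y < h)) tau.
case: v => [|z v] in def_tau v_head.
  by exists u, [::], [::]; rewrite def_tau.
rewrite negbK in v_head.
have sub_v : subseq (z :: v) tau by rewrite def_tau suffix_subseq.
move/pairwiseP2: shape_layer => lay.
have {}lay x y : subseq [:: x; y] (z :: v) -> [/\ layer h x y, x != y, x != h & y != h].
  move/subseq_trans/(_ sub_v) => sub.
  by have [xy xh yh] := shape_neq sub; split=> //; apply: lay.
(* A low letter [y] after [z] would make [h z y n] a 3214. *)
have high_v : {in z :: v, forall y, c <= y}.
  move=> y; rewrite inE => /predU1P[-> | yv]; first by lia.
  have sub_zy : subseq [:: z; y] tau.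
    by apply: subseq_trans sub_v; rewrite /= eqxx sub1seq.
  case: av => _ _ /(_ _ _ _ _ (shape_subseq (sub0seq _) sub_zy (mem_head _ _))).
  have : h < n by apply: max_n; rewrite mem_cat mem_head orbT.
  by lia.
(* Otherwise [z x y c] would be a 2431, where [z < y] comes from [layer h]. *)
have sml_first x y : subseq [:: x; y] (z :: v) -> y < h -> x < h.
  rewrite /=; case: (eqVneq x z) => [-> _ _| xz sub yh]; first by lia.
  have [xv yv] : x \in v /\ y \in v by move/subseq_mem_all: sub => /and3P[].
  have := lay z y; rewrite /= eqxx sub1seq yv => /(_ isT) [].
  have := lay x y (subseq_trans sub (subseq_cons _ _)).
  have c_nb : c \in n :: beta by rewrite inE c_beta orbT.
  have sub_zxy : subseq [:: z; x; y] tau.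
    by apply: subseq_trans sub_v; rewrite /= eqxx.
  case: av => _ + _ => /(_ z x y c).
  have -> : subseq [:: z; x; y; c] w.
    apply: subseq_trans (shape_subseq (sub0seq _) sub_zxy c_nb).
    exact: subseq_cons.
  have := high_v z (mem_head _ _); have := @high_v y; rewrite inE yv orbT => /(_ isT).
  have /(subseq_uniq)/(_ uniq_w) := shape_subseq (sub0seq _) sub_zxy c_nb.
  rewrite /= !inE !negb_or => /and3P[_ /and3P[_ _ zc] _].
  move=> cy cz /(_ isT) + [+ _ _ _] [+ zy _ _]; rewrite /layer; lia.
exists u, [seq y <- z :: v | y < h], [seq y <- z :: v | ~~ (y < h)].
split=> //; first by rewrite def_tau -cat_filter.
- by rewrite /=; case: ifP => // ; lia.
- by apply/allP=> y; rewrite mem_filter => /andP[yh /high_v]; lia.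
- by apply/allP=> y; rewrite mem_filter => /andP[yh /high_v]; lia.
Qed.

(** The blocks are listed by increasing value; [sigma] and [beta], whose order is free, enter
    through their sorted letters. For a permutation this list has to be [iota], which fixes the
    range of every block. *)
Lemma shape_sorted u S T : tau = u ++ S ++ T ->
  all (fun y => ~~ (c <= y < h)) u -> all (fun y => c <= y < h) S ->
  all (leq h) T ->
  pairwise ltn (sort leq sigma ++ [seq y <- h :: u | y < c] ++ sort leq beta ++
    S ++ [seq y <- h :: u | c <= y] ++ T ++ [:: n]).
Proof.
move=> def_tau /allP uP /allP SP /allP TP.
have [sub_u sub_S sub_T] : [/\ subseq u tau, subseq S tau & subseq T tau].
  rewrite def_tau prefix_subseq; split=> //; last by rewrite catA suffix_subseq.
  exact: subseq_trans (prefix_subseq _ _) (suffix_subseq _ _).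
have lay x y : subseq [:: x; y] tau -> [/\ layer h x y, x != y, x != h & y != h].
  move=> sub.
  by have [xy xh yh] := shape_neq sub; split=> //; move/pairwiseP2: shape_layer; apply.
have tau_h x : x \in tau -> x != h.
  move=> xt; have /(subseq_uniq)/(_ uniq_w) :=
    @shape_subseq [::] [:: x] n (sub0seq _) (etrans (sub1seq _ _) xt) (mem_head _ _).
  by rewrite /= !inE negb_or eq_sym => /andP[/andP[]].
have sorted_sort s : subseq s w -> pairwise ltn (sort leq s).
  move=> /subseq_uniq/(_ uniq_w) uniq_s.
  rewrite -sorted_pairwise; last exact: ltn_trans.
  by rewrite ltn_sorted_uniq_leq sort_uniq uniq_s sort_sorted //; apply: leq_total.
have hn : h < n by apply: max_n; rewrite mem_cat mem_head orbT.
have tau_n x : x \in tau -> x < n.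
  by move=> xt; apply: max_n; rewrite !(mem_cat, inE) xt !orbT.
have mem_hi x : x \in [seq y <- h :: u | c <= y] ->
    [/\ h <= x, x < n & x = h \/ x \in u /\ x != h].
  rewrite mem_filter inE => /andP[cx /predU1P[-> | xu]]; first by split=> //; left.
  have xt := mem_subseq sub_u xu; have := tau_h _ xt; have := uP _ xu.
  by split; [lia | exact: tau_n | right].
have mem_lo x : x \in [seq y <- h :: u | y < c] -> x < c /\ x \in tau.
  rewrite mem_filter inE => /andP[xc /predU1P[x_h | /(mem_subseq sub_u) //]]; lia.
have mem_S x : x \in S -> [/\ c <= x, x < h & x \in tau].
  by move=> xS; have /andP[] := SP _ xS; split=> //; apply: mem_subseq xS.
have mem_T x : x \in T -> [/\ h < x, x < n & x \in tau].
  move=> xT; have xt := mem_subseq sub_T xT; have := tau_h _ xt; have := TP _ xT.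
  by split; [lia | exact: tau_n | ].
have mem_b x : x \in beta -> [/\ c <= x, x < h & x < n].
  move=> xb; split; first exact: c_min.
    by apply: beta_interval; rewrite ?mem_head.
  by apply: max_n; rewrite !mem_cat xb !orbT.
(* Each block in turn is compared with all later ones and then shown to be increasing. *)
rewrite !pairwise_cat; repeat (apply/andP; split) => //.
- apply/allrelP => x y; rewrite mem_sort => xs; have xc := sigma_c xs.
  rewrite !mem_cat mem_sort inE => /or4P[/mem_lo[_]|/mem_b[]|/mem_S[]|/or3P[/mem_hi[]|/mem_T[]|/eqP->]]; try (rewrite /=; lia).
  exact: shape_sigma_low.
- by apply: sorted_sort; apply: prefix_subseq.
- apply/allrelP => x y /mem_lo[xc _].
  rewrite !mem_cat mem_sort inE => /or4P[/mem_b[]|/mem_S[]|/mem_hi[]|/orP[/mem_T[]|/eqP->]]; rewrite /=; lia.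
- apply: pairwise_filterP => x y /=; case: eqP => [-> _|_]; first by lia.
  move=> sub xc yc; have [] := lay _ _ (subseq_trans sub sub_u).
  by rewrite /layer; lia.
- apply/allrelP => x y; rewrite mem_sort => xb; have [cx xh xn] := mem_b _ xb.
  rewrite !mem_cat inE => /or4P[/mem_S[cy _ yt]|/mem_hi[]|/mem_T[]|/eqP->]; try (rewrite /=; lia).
  by apply: beta_interval; rewrite // inE yt orbT.
- apply: sorted_sort; apply: subseq_trans (suffix_subseq _ _).
  by apply: subseq_trans (suffix_subseq _ _); apply: subseq_cons.
- apply/allrelP => x y /mem_S[].
  rewrite !mem_cat inE => ? ? ? /or3P[/mem_hi[]|/mem_T[]|/eqP->]; rewrite /=; lia.
- apply/pairwiseP2 => x y sub; have [] := lay _ _ (subseq_trans sub sub_S).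
  have /and3P[/mem_S[_ xh _] /mem_S[_ yh _] _] := subseq_mem_all sub.
  by rewrite /layer /=; lia.
- apply/allrelP => x y /mem_hi[hx xn x_or].
  rewrite mem_cat inE => /orP[yT|/eqP-> //]; have [hy yn yt] := mem_T _ yT.
  case: x_or => [-> //|[xu xh]].
  have sub : subseq [:: x; y] tau.
    rewrite def_tau; apply: (@cat_subseq _ [:: x]); first by rewrite sub1seq.
    by rewrite sub1seq mem_cat yT orbT.
  by have [] := lay _ _ sub; rewrite /layer /=; lia.
- rewrite /= c_h /=; apply/andP; split.
    apply/allP=> x xf; have /mem_hi[hx _ [xh|[_]]] : x \in [seq y <- h :: u | c <= y].
    + by rewrite /= c_h inE xf orbT.
    + by move: xf; rewrite mem_filter xh => /andP[_ /(mem_subseq sub_u)/tau_h]; rewrite eqxx.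
    + by rewrite /=; lia.
  apply: pairwise_filterP => x y sub cx cy.
  have /and3P[/uP + /uP + _] := subseq_mem_all sub.
  by have [] := lay _ _ (subseq_trans sub sub_u); rewrite /layer /=; lia.
- by apply/allrelP => x y /mem_T[_ xn _]; rewrite inE => /eqP->.
apply/pairwiseP2 => x y sub; have [] := lay _ _ (subseq_trans sub sub_T).
have /and3P[/mem_T[hx _ _] /mem_T[hy _ _] _] := subseq_mem_all sub.
by rewrite /layer /=; lia.
Qed.

End Shape.

(** * Reading the parameters off a word *)

Lemma cat_iota (u v : seq nat) i n : u ++ v = iota i n ->
  u = iota i (size u) /\ v = iota (i + size u) (size v).
Proof.
move=> eq_uv; have size_n : n = size u + size v by rewrite -size_cat eq_uv size_iota.
move/eqP: eq_uv; rewrite size_n iotaD eqseq_cat ?size_iota //.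
by case/andP=> /eqP<- /eqP<-.
Qed.

(** The increasing list is a rearrangement of [w], so it equals [iota]; [cat_iota] then cuts it into
    the intervals prescribed by [build]. The shuffle is [u], with bits given by comparison with
    [c]. *)
Lemma layout n c (sigma u S T beta : seq nat) :
  let w := sigma ++ (u ++ S ++ T) ++ n :: beta in
  perm_eq w (iota 0 (size w)) -> c \in beta -> {in beta, forall y, c <= y} ->
  pairwise ltn (sort leq sigma ++ [seq y <- u | y < c] ++ sort leq beta ++
    S ++ [seq y <- u | c <= y] ++ T ++ [:: n]) ->
  exists beta', [/\ perm_eq sigma (iota 0 (size sigma)),
    perm_eq beta' (iota 0 (size beta')), beta = [seq c + y | y <- beta'] &
    w = build sigma [seq c <= y | y <- u] (size S) (size T) beta'].
Proof.
move=> w perm_w c_beta c_min; set L := (X in pairwise _ X) => ltn_L.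
have perm_L : perm_eq L w.
  apply/seq.permP => a; rewrite /L /w !count_cat /= !(seq.permP (permEl (perm_sort _ _))).
  rewrite -(seq.permP (permEl (perm_filterC (fun y => y < c) u))) count_cat.
  rewrite (eq_filter (a1 := predC _) (a2 := leq c)); last by move=> y; rewrite /= -leqNgt.
  ring.
have : L = iota 0 (size w).
  apply: (irr_sorted_eq ltn_trans ltnn); first by rewrite sorted_pairwise //; apply: ltn_trans.
    exact: iota_ltn_sorted.
  by apply: perm_mem; apply: perm_trans perm_L perm_w.
rewrite /L => /cat_iota[s_sigma /cat_iota[def_lo /cat_iota[s_beta]]].
move=> /cat_iota[def_S /cat_iota[def_hi /cat_iota[def_T def_n]]].
rewrite !size_sort !add0n in s_sigma def_lo s_beta def_S def_hi def_T def_n.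
have size_lo : size [seq y <- u | y < c] = count negb [seq c <= y | y <- u].
  by rewrite size_filter count_map; apply: eq_count => y; rewrite /= ltnNge.
have size_hi : size [seq y <- u | c <= y] = count id [seq c <= y | y <- u].
  by rewrite size_filter count_map.
rewrite size_lo size_hi in def_lo s_beta def_S def_hi def_T def_n.
have perm_b : perm_eq beta (iota (size sigma + count negb [seq c <= y | y <- u]) (size beta)).
  by rewrite -s_beta perm_sym perm_sort.
(* The letters of [beta] form an interval, and [c] is its least element. *)
have def_c : c = size sigma + count negb [seq c <= y | y <- u].
  have := c_beta; rewrite (perm_mem perm_b) mem_iota => /andP[c_ge _].
  apply/eqP; rewrite eqn_leq c_ge andbT; apply: c_min.
  by rewrite (perm_mem perm_b) mem_iota leqnn; case: (beta) c_beta => //= *; lia.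
exists [seq y - c | y <- beta]; split.
- by rewrite -s_sigma perm_sym perm_sort.
- rewrite size_map; have <- : [seq y - c | y <- iota c (size beta)] = iota 0 (size beta).
    rewrite -{2}[c]addn0 iotaDl -map_comp -[RHS]map_id; apply: eq_map => y /=.
    exact: addKn.
  by rewrite perm_map // {1}def_c.
- rewrite -map_comp map_id_in // => y /c_min /= cy; exact: subnKC.
rewrite -def_c in def_S def_hi def_T def_n.
rewrite /w /build size_map -def_c -map_comp map_id_in; last by move=> y /c_min /= cy; apply: subnKC.
case: def_n => def_n; rewrite -def_n -def_T -def_S; congr (_ ++ (_ ++ _) ++ _).
by rewrite (weaveK def_lo def_hi).
Qed.

(* [None] is the empty shuffle; in [Some (b, o)] the shuffle word is [true :: b],
   and [o] is [None] for s = t = 0 and [Some (s, t)] for blocks of sizes s + 1, t. *)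
Definition interleaving := option (seq bool * option (nat * nat)).

Definition buildE (sigma : seq nat) (e : interleaving) (beta : seq nat) :=
  match e with
  | None => build sigma [::] 0 0 beta
  | Some (b, None) => build sigma (true :: b) 0 0 beta
  | Some (b, Some (s, t)) => build sigma (true :: b) s.+1 t beta
  end.

(** * Existence of the decomposition *)

Lemma perm_rcons_iota (s : seq nat) :
  perm_eq (rcons s (size s)) (iota 0 (size s).+1) = perm_eq s (iota 0 (size s)).
Proof.
by rewrite -addn1 iotaD add0n cats1 perm_rcons perm_sym perm_rcons perm_cons perm_sym.
Qed.

(** A 321 in [s] followed by [n] would be a 3214. *)
Lemma avF_prefix (s : seq nat) n t : avF (s ++ n :: t) ->
  {in s, forall y, y < n} -> avA s.
Proof.
case=> av1 _ av3 s_n; split=> [a b c sub|a b c d sub].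
  have /av3 : subseq ([:: a; b; c] ++ [:: n]) (s ++ n :: t).
    by apply: cat_subseq sub _; rewrite sub1seq mem_head.
  by have /andP[/s_n + _] := subseq_mem_all sub; lia.
by apply: av1; apply: subseq_trans sub (prefix_subseq _ _).
Qed.

Lemma permF_rcons (s : seq nat) : permA s <-> permF (rcons s (size s)).
Proof.
rewrite /permA /permF size_rcons perm_rcons_iota; split=> -[perm_s av]; split=> //.
  by apply: avF_rcons => // y; rewrite (perm_mem perm_s) mem_iota.
rewrite -cats1 in av; apply: avF_prefix av _ => y.
by rewrite (perm_mem perm_s) mem_iota.
Qed.

(** The word is cut at its largest letter [n]. The first case is that of [n] in last position;
    otherwise the least letter [c] of [beta] separates low letters from high ones. *)
Lemma permF_split w : permF w -> w <> [::] ->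
  (exists2 sigma, permA sigma & w = rcons sigma (size sigma)) \/
  (exists sigma e beta,
    [/\ permA sigma, permF beta, beta <> [::] & w = buildE sigma e beta]).
Proof.
move=> permF_w w_nz; case: (permF_w) => perm_w av.
have : (size w).-1 \in w by rewrite (perm_mem perm_w) mem_iota; case: (w) w_nz => //= *; lia.
have le_w : {in w, forall y, y <= (size w).-1}.
  by move=> y; rewrite (perm_mem perm_w) mem_iota; lia.
have uniq_w : uniq w by rewrite (perm_uniq perm_w) iota_uniq.
move def_n : (size w).-1 => n n_w.
case/splitPr: n_w => alpha beta in w_nz permF_w perm_w av uniq_w le_w def_n *.
rewrite def_n in le_w.
have max_n : {in alpha ++ beta, forall y, y < n}.
  move=> y y_ab; rewrite ltn_neqAle le_w ?andbT; last first.
    by rewrite mem_cat inE orbCA -mem_cat y_ab orbT.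
  by apply: contraTneq uniq_w => y_n; rewrite -cat1s uniq_catCA /= -y_n y_ab.
case: beta => [|y0 beta0] in w_nz permF_w perm_w av uniq_w le_w def_n max_n *.
  have n_alpha : n = size alpha by rewrite -def_n size_cat addn1.
  left; exists alpha; last by rewrite -n_alpha cats1.
  by apply/permF_rcons; rewrite -n_alpha -cats1.
right; move def_beta : (y0 :: beta0) => beta in permF_w perm_w av uniq_w le_w def_n max_n *.
have beta_nz : beta <> [::] by rewrite -def_beta.
have [c c_beta c_min] := seq_min beta_nz.
have avA_alpha : avA alpha.
  by apply: avF_prefix av _ => y ya; apply: max_n; rewrite mem_cat ya.
(* If [c < x < y], then [x n c y] is a 2413 and [x n y c] a 2431; one of them occurs, according to
   the order of [c] and [y] in [beta]. *)
have interval : {in alpha & beta, forall x y, c <= x -> y < x}.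
  move=> x y xa yb cx; rewrite ltnNge; apply/negP => xy.
  have nx z : z \in beta -> x != z.
    move=> zb; have : subseq [:: x; z] (alpha ++ n :: beta).
      by apply: (@cat_subseq _ [:: x]); rewrite sub1seq // inE zb orbT.
    exact: subseq_uniq_pair.
  have nxc := nx _ c_beta; have nxy := nx _ yb.
  have yn : y < n by apply: max_n; rewrite mem_cat yb orbT.
  have cy : c != y by lia.
  have sub4 u v : subseq [:: u; v] beta -> subseq [:: x; n; u; v] (alpha ++ n :: beta).
    move=> sub; apply: (@cat_subseq _ [:: x]); first by rewrite sub1seq.
    by rewrite /= eqxx.
  by case: av => /(_ x n c y) + /(_ x n y c) + _;
    case/orP: (subseq_pair c_beta yb cy) => /sub4 ->; lia.
have avF_b beta' : beta = [seq c + y | y <- beta'] -> avF beta'.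
  move=> def_b; apply/(avF_map c); rewrite -def_b; apply: avF_sub av.
  exact: subseq_trans (subseq_cons _ _) (suffix_subseq _ _).
have [sigma [tau [def_alpha sigma_c tau_head]]] := span_seq (gtn c) alpha.
have {}sigma_c : {in sigma, forall y, y < c} by apply/allP.
have nz_b beta' : beta = [seq c + y | y <- beta'] -> beta' <> [::].
  by move=> + b_nil; rewrite b_nil => /beta_nz.
(* Without high letters [alpha] is [sigma], and both the shuffle and the blocks are empty. *)
case: tau => [|h tau] in def_alpha tau_head.
  rewrite cats0 in def_alpha; subst alpha.
  have [|beta' [perm_s perm_b def_b def_w]] :=
      @layout n c sigma [::] [::] [::] beta perm_w c_beta c_min.
    have uniq_cat s : subseq s (sigma ++ n :: beta) -> pairwise ltn (sort leq s).
      move=> /subseq_uniq/(_ uniq_w) uniq_s.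
      rewrite -sorted_pairwise; last exact: ltn_trans.
      by rewrite ltn_sorted_uniq_leq sort_uniq uniq_s sort_sorted //; apply: leq_total.
    rewrite !cat0s !pairwise_cat /= !andbT; repeat (apply/andP; split).
    - apply/allrelP=> x y; rewrite mem_cat !mem_sort inE => xs.
      case/orP=> [/c_min|/eqP->]; first by have /= := sigma_c _ xs; lia.
      by apply: max_n; rewrite mem_cat xs.
    - by apply: uniq_cat; apply: prefix_subseq.
    - apply/allrelP=> x y; rewrite mem_sort inE => xb /eqP->.
      by apply: max_n; rewrite mem_cat xb orbT.
    - by apply: uniq_cat; apply: subseq_trans (subseq_cons _ _) (suffix_subseq _ _).
  exists sigma, None, beta'; split=> //; last exact: nz_b def_b.
  by split=> //; apply: avF_b.
have c_h : c <= h by rewrite leqNgt.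
subst alpha; rewrite -catA in perm_w av uniq_w.
have max_n' : {in sigma ++ (h :: tau) ++ beta, forall y, y < n}.
  by move=> y; rewrite catA; apply: max_n.
have interval' : {in h :: tau & beta, forall x y, c <= x -> y < x}.
  by move=> x y xt; apply: interval; rewrite mem_cat xt orbT.
have avA_s : avA sigma by apply: avA_sub avA_alpha; apply: prefix_subseq.
have [u [S [T [def_tau ST uP SP TP]]]] :=
  shape_tail av uniq_w max_n' c_beta c_h.
have ltn_L := shape_sorted av uniq_w max_n' c_beta c_min sigma_c c_h interval' def_tau uP SP TP.
have perm_w' : perm_eq (sigma ++ ((h :: u) ++ S ++ T) ++ n :: beta)
    (iota 0 (size (sigma ++ ((h :: u) ++ S ++ T) ++ n :: beta))).
  by rewrite def_tau in perm_w.
have [beta' [perm_s perm_b def_b def_w]] := layout perm_w' c_beta c_min ltn_L.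
rewrite /= c_h in def_w.
(* The leading bit, that of [h], is always true and is not stored. If [S] is empty then so is [T],
   which leaves no block data. *)
exists sigma, (Some ([seq c <= y | y <- u], if S is z :: S' then Some (size S', size T) else None)), beta'.
split; [by split | by split=> //; apply: avF_b | exact: nz_b def_b | ].
rewrite -catA /= def_tau def_w; case: (S) ST => //= ->; rewrite //.
Qed.

Lemma permF_buildE sigma e beta : permA sigma -> permF beta ->
  permF (buildE sigma e beta).
Proof.
move=> pA pF; case: (pA) (pF) => perm_s _ [perm_b _].
by case: e => [[b [[s t]|]]|]; split; (apply: build_perm || apply: build_avF).
Qed.

Lemma permA_rcons sigma : permA sigma -> permA (rcons sigma (size sigma)).
Proof.
move=> pA; case: (pA) => perm_s [av1 _]; have /permF_rcons[perm_w [av2 _ _]] := pA.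
split=> //; split=> //; rewrite -cats1; apply: avoids321_cat => //.
  by move=> a b c /size_subseq.
by move=> x y; rewrite inE (perm_mem perm_s) mem_iota => xs /eqP->.
Qed.

Definition liftE (b : option (seq bool)) : interleaving :=
  omap (fun b => (b, None)) b.

Lemma permA_buildE sigma b m : permA sigma ->
  permA (buildE sigma (liftE b) (iota 0 m)).
Proof.
move=> pA; case: (pA) => perm_s _.
have perm_b : perm_eq (iota 0 m) (iota 0 (size (iota 0 m))) by rewrite size_iota.
by case: b => [b|]; split; (apply: build_perm || apply: build_avA).
Qed.

(** An avoider of A lies in [permF], so it decomposes; avoiding 321 then excludes the two blocks and
    makes [beta] increasing. *)
Lemma permA_split w : permA w -> w <> [::] ->
  (exists2 sigma, permA sigma & w = rcons sigma (size sigma)) \/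
  (exists sigma b m, permA sigma /\ w = buildE sigma (liftE b) (iota 0 m.+1)).
Proof.
case=> perm_w av w_nz; have permF_w : permF w by split=> //; apply: avA_avF.
case: (permF_split permF_w w_nz) => [|[sigma [e [beta [pA [perm_b av_b] b_nz def_w]]]]].
  by left.
right; case: av => av1 _.
(* The largest letter followed by a descent of [beta] would be a 321. *)
have av_build b s t : w = build sigma b s t beta -> beta = iota 0 (size beta).
  move=> {}def_w; apply: (irr_sorted_eq ltn_trans ltnn); last exact: perm_mem.
    rewrite sorted_pairwise; last exact: ltn_trans.
    apply/pairwiseP2 => x y sub.
    have uniq_b : uniq beta by rewrite (perm_uniq perm_b) iota_uniq.
    have xy := subseq_uniq_pair uniq_b sub.
    have /and3P[xb yb _] := subseq_mem_all sub.
    move: (xb) (yb); rewrite /= (perm_mem perm_b) !mem_iota => xm ym.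
    set c := size sigma + count negb b.
    have /av1 : subseq [:: c + size beta + s + count id b + t; c + x; c + y] w.
      rewrite def_w /build; apply: subseq_trans (suffix_subseq _ _).
      apply: subseq_trans (suffix_subseq _ _); rewrite /= eqxx.
      exact: (map_subseq (addn c) sub).
    by lia.
  exact: iota_ltn_sorted.
have m_pos : size beta = (size beta).-1.+1 by case: (beta) b_nz.
have perm0 : 0 \in beta by rewrite (perm_mem perm_b) mem_iota m_pos.
case: e def_w => [[b [[s t]|]]|] def_w.
(* The first high letter, the first letter of block [s] and the least letter of the shifted [beta]
   form a 321. *)
- exfalso; set c := size sigma + count negb (true :: b) in def_w.
  have /av1 : subseq [:: c + size beta + s.+1; c + size beta; c + 0] w; last by lia.
  rewrite def_w /build -/c; apply: subseq_trans (suffix_subseq _ _).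
  apply: (@cat_subseq _ [:: c + size beta + s.+1; c + size beta]); last first.
    by rewrite sub1seq inE map_f ?orbT.
  apply: (@cat_subseq _ [:: c + size beta + s.+1]); rewrite sub1seq.
    exact: mem_head.
  by rewrite mem_cat mem_iota leqnn addnS ltnS leq_addr.
- exists sigma, (Some b), (size beta).-1; split=> //.
  by rewrite -m_pos -(av_build _ _ _ def_w).
- exists sigma, None, (size beta).-1; split=> //.
  by rewrite -m_pos -(av_build _ _ _ def_w).
Qed.

(** * Uniqueness of the decomposition *)

Lemma span_inj (T : Type) (p : pred T) u u' x x' v v' :
  all p u -> all p u' -> ~~ p x -> ~~ p x' ->
  u ++ x :: v = u' ++ x' :: v' -> [/\ u = u', x = x' & v = v'].
Proof.
elim: u u' => [|y u IHu] [|y' u'] //=.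
- by move=> _ _ _ _ [-> ->].
- by move=> _ /andP[py' _] /negP px _ [xy _]; case: px; rewrite xy.
- by move=> /andP[py _] _ _ /negP px [xy _]; case: px; rewrite -xy.
by move=> /andP[_ pu] /andP[_ pu'] px px' [-> /IHu[] // -> -> ->].
Qed.

(** The shift is recovered as the least letter, which exists because [s] is nonempty. *)
Lemma shift_inj c c' (s s' : seq nat) :
  perm_eq s (iota 0 (size s)) -> perm_eq s' (iota 0 (size s')) -> s <> [::] ->
  [seq c + y | y <- s] = [seq c' + y | y <- s'] -> c = c' /\ s = s'.
Proof.
move=> perm_s perm_s' s_nz eq_s; have m_pos : 0 < size s by case: (s) s_nz.
have eq_m : size s = size s' by rewrite -(size_map (addn c)) eq_s size_map.
have cc' : c = c'.
  have := mem_shift c c perm_s; have := mem_shift c' c' perm_s'.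
  have := mem_shift c' c perm_s'; have := mem_shift c c' perm_s.
  rewrite -eq_s; lia.
by split=> //; move: eq_s; rewrite cc'; apply: inj_map; apply: addnI.
Qed.

Lemma build_last_inj sigma b s t beta sigma' b' s' t' beta' :
  let n := size sigma + count negb b + size beta + s + count id b + t in
  build sigma b s t beta = build sigma' b' s' t' beta' ->
  n = size sigma' + count negb b' + size beta' + s' + count id b' + t'.
Proof.
move=> n /(congr1 size); rewrite !size_build /n -!count_negb_id.
move: (count _ _) (count _ _) (count _ _) (count _ _) => x1 x2 x3 x4.
by move: (size _) (size _) (size _) (size _) => *; lia.
Qed.

(** A normal form of the parameters: a leading low letter could be moved into [sigma], and if the
    shuffle or block [s] is empty, the next block could be taken as high letters of the shuffle. *)
Definition grid b s t := ((s == 0) ==> (t == 0)) && (if b is x :: _ then x else s == 0).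

Lemma build_cat (sigma beta : seq nat) b s t :
  perm_eq sigma (iota 0 (size sigma)) ->
  let c := size sigma + count negb b in
  let n := c + size beta + s + count id b + t in
  exists2 alpha, build sigma b s t beta = alpha ++ n :: [seq c + y | y <- beta] &
    all (gtn n) alpha.
Proof.
move=> perm_s c n; set h := c + size beta + s.
exists (sigma ++ weave b (size sigma) h ++ iota (c + size beta) s ++
         iota (h + count id b) t); first by rewrite /build -!catA.
apply/allP => x; rewrite !mem_cat (perm_mem perm_s) mem_weave !mem_iota /n /h /c /=.
by move: (count _ _) (count _ _) (size _) (size _) => *; lia.
Qed.

(** The parameters are recovered one after another: the largest letter isolates the shifted [beta],
    which gives the shift [c]; [sigma] is the prefix below [c]; the first high letter gives [s]; the
    shuffle gives [b], and the total size leaves [t]. *)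
Lemma build_inj (sigma beta sigma' beta' : seq nat) b s t b' s' t' :
  perm_eq sigma (iota 0 (size sigma)) -> perm_eq sigma' (iota 0 (size sigma')) ->
  perm_eq beta (iota 0 (size beta)) -> perm_eq beta' (iota 0 (size beta')) ->
  beta <> [::] -> grid b s t -> grid b' s' t' ->
  build sigma b s t beta = build sigma' b' s' t' beta' ->
  [/\ sigma = sigma', b = b', s = s', t = t' & beta = beta'].
Proof.
move=> perm_s perm_s' perm_b perm_b' b_nz g g' eq_w.
have eq_n := build_last_inj eq_w.
have [alpha def_w alpha_n] := build_cat beta b s t perm_s.
have [alpha' def_w' alpha_n'] := build_cat beta' b' s' t' perm_s'.
rewrite -eq_n in def_w' alpha_n'.
have := eq_w; rewrite def_w def_w' => /(span_inj alpha_n alpha_n').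
rewrite /= ltnn => /(_ isT isT) [_ _ /(shift_inj perm_b perm_b' b_nz)].
case=> eq_c eq_b; subst beta' => {alpha alpha' def_w def_w' alpha_n alpha_n'}.
move: eq_w; rewrite /build -eq_n -eq_c.
have c_sigma : size sigma <= size sigma + count negb b by apply: leq_addr.
have c_sigma' : size sigma' <= size sigma + count negb b by rewrite eq_c leq_addr.
have b_c' : size sigma' + count negb b' <= size sigma + count negb b by rewrite eq_c.
rewrite -eq_c in eq_n; move: eq_n {eq_c} c_sigma c_sigma' b_c'.
move def_c : (size sigma + count negb b) (size beta) => c m.
have {def_c} b_c : size sigma + count negb b <= c by rewrite def_c.
move def_n : (c + m + s + _ + t) => n /esym def_n' c_sigma c_sigma' b_c'.
have sigma_c : all (gtn c) sigma.
  by apply/allP => x; rewrite (perm_mem perm_s) mem_iota /=; lia.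
have sigma_c' : all (gtn c) sigma'.
  by apply/allP => x; rewrite (perm_mem perm_s') mem_iota /=; lia.
(* The rest of the shuffle ends at the first letter failing this test: the start of block [s], or
   [n] if there is no block. *)
have weave_span b1 s1 i : i + count negb b1 <= c -> c + m + s1 + count id b1 < n ->
    all (fun x => (x < c) || (c + m + s1 <= x < n)) (weave b1 i (c + m + s1).+1).
  move=> b1c b1n; apply/allP => x; rewrite mem_weave; lia.
have nc : ~~ gtn c n by rewrite -leqNgt -def_n -!addnA leq_addr.
rewrite -!catA.
have grid_true b0 s0 t0 : grid (false :: b0) s0 t0 = false by rewrite /grid andbF.
case: b b' => [|[] b] [|[] b'] in g g' b_c b_c' def_n def_n' *; rewrite ?grid_true // in g g'.
- case: s s' t t' {def_n def_n'} g g' => [|s] [|s'] [|t] [|t'] // _ _.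
  by move/(span_inj sigma_c sigma_c' nc nc) => [->].
(* With an empty shuffle [sigma] is followed by [n], with a nonempty one by a smaller high
   letter. *)
- case: s t g def_n => [|s] [|t] // _ def_n eq_w; rewrite /= in def_n'.
  by have [||_ n_h _] := span_inj sigma_c sigma_c' _ _ eq_w; rewrite /=; lia.
- case: s' t' g' def_n' => [|s'] [|t'] // _ def_n' eq_w; rewrite /= in def_n.
  by have [||_ n_h _] := span_inj sigma_c sigma_c' _ _ eq_w; rewrite /=; lia.
rewrite /= in def_n def_n' b_c b_c' *.
move=> eq_w; have [||eq_s hh eq_tl] := span_inj sigma_c sigma_c' _ _ eq_w; try (rewrite /=; lia).
have {hh eq_w} ss : s = s' by lia.
subst s' sigma'.
have {eq_tl} eq_b : b = b'.
  have eq_weave : weave b (size sigma) (c + m + s).+1 = weave b' (size sigma) (c + m + s).+1.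
    have wb := @weave_span b s (size sigma); have wb' := @weave_span b' s (size sigma).
    case: s t t' g g' def_n def_n' wb wb' eq_tl => [|s] [|t] [|t'] // _ _ def_n def_n' wb wb';
      rewrite /= => eq_tl; have [||||||-> //] := span_inj (wb _ _) (wb' _ _) _ _ eq_tl; rewrite /=; lia.
  rewrite -(@map_weave b (size sigma) (c + m + s).+1 c) ?eq_weave ?map_weave //; lia.
subst b'; split=> //; lia.
Qed.

Definition coords (e : interleaving) : seq bool * nat * nat :=
  match e with
  | None => ([::], 0, 0)
  | Some (b, None) => (true :: b, 0, 0)
  | Some (b, Some (s, t)) => (true :: b, s.+1, t)
  end.

Lemma coords_inj : injective coords.
Proof. by case=> [[b [[s t]|]]|] [[b' [[s' t']|]]|] //= [] => *; subst. Qed.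

Lemma buildE_coords sigma e beta :
  buildE sigma e beta = build sigma (coords e).1.1 (coords e).1.2 (coords e).2 beta.
Proof. by case: e => [[b [[s t]|]]|]. Qed.

Lemma buildE_inj (sigma beta sigma' beta' : seq nat) e e' :
  permA sigma -> permA sigma' -> permF beta -> permF beta' -> beta <> [::] ->
  buildE sigma e beta = buildE sigma' e' beta' ->
  [/\ sigma = sigma', e = e' & beta = beta'].
Proof.
move=> [perm_s _] [perm_s' _] [perm_b _] [perm_b' _] b_nz; rewrite !buildE_coords.
have grid_coords e0 : grid (coords e0).1.1 (coords e0).1.2 (coords e0).2.
  by case: e0 => [[b [[s t]|]]|].
case/(build_inj perm_s perm_s' perm_b perm_b' b_nz (grid_coords e) (grid_coords e')).
move=> -> eq_b eq_s eq_t ->; split=> //; apply: coords_inj.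
by move: (coords e) (coords e') eq_b eq_s eq_t => [[? ?] ?] [[? ?] ?] /= -> -> ->.
Qed.

(** The largest letter is last on the right, but on the left it is followed by the nonempty
    [beta]. *)
Lemma buildE_rcons (sigma beta sigma' : seq nat) e :
  permA sigma -> permA sigma' -> beta <> [::] ->
  buildE sigma e beta <> rcons sigma' (size sigma').
Proof.
move=> [perm_s _] [perm_s' _] b_nz; rewrite buildE_coords.
move: (coords e) => [[b s] t] /= eq_w.
have [alpha def_w alpha_n] := build_cat beta b s t perm_s.
have eq_n : size sigma + count negb b + size beta + s + count id b + t = size sigma'.
  move: (congr1 size eq_w); rewrite size_rcons size_build -count_negb_id.
  by move: (count _ _) (count _ _) (size _) (size _) (size _) => *; lia.
have sigma_n : all (gtn (size sigma')) sigma'.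
  by apply/allP => x; rewrite (perm_mem perm_s') mem_iota.
rewrite def_w -cats1 eq_n in eq_w alpha_n.
have [||_ _] := span_inj alpha_n sigma_n _ _ eq_w; rewrite /= ?ltnn //.
by case: (beta) b_nz.
Qed.

Definition rank (e : interleaving) : nat :=
  if e is Some (b, o) then
    (size b + (if o is Some (s, t) then (s + t).+1 else 0)).+1 else 0.

Lemma size_buildE sigma e beta :
  size (buildE sigma e beta) = (size sigma + rank e + size beta).+1.
Proof.
case: e => [[b [[s t]|]]|]; rewrite /= size_build /=;
  move: (size _) (size _) => *; lia.
Qed.

(** * Counting graded families *)

Section Counting.
Local Open Scope ring_scope.

(** The series 1 + x f. *)
Definition fps_option (f : fps rat) : fps rat := fun n => if n is n'.+1 then f n' else 1.
Definition fps_add (f g : fps rat) : fps rat := fun n => f n + g n.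
Definition fps_pos (f : fps rat) : fps rat := fun n => if n == 0%N then 0 else f n.

(** [f] is the generating function of [P] by the weight [wt]. Explicit lists of the objects of each
    weight allow [P] to be an arbitrary proposition on an infinite type. *)
Definition counted (T : eqType) (P : T -> Prop) (wt : T -> nat) (f : fps rat) :=
  exists L : nat -> seq T, forall n,
    [/\ uniq (L n), (forall x, x \in L n <-> P x /\ wt x = n) & f n = (size (L n))%:R].

Lemma counted_unique (T : eqType) (P : T -> Prop) wt f g :
  counted P wt f -> counted P wt g -> f =1 g.
Proof.
case=> L Lf [M Mg] n; have [uL mL ->] := Lf n; have [uM mM ->] := Mg n.
congr _%:R; apply/perm_size/uniq_perm => // x.
by apply/idP/idP => [/mL/mM|/mM/mL].
Qed.

Lemma counted_image (T U : eqType) (P : T -> Prop) (Q : U -> Prop) wt wt' f h :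
  counted P wt f -> (forall x y, P x -> P y -> h x = h y -> x = y) ->
  (forall x, P x -> wt' (h x) = wt x) ->
  (forall y, Q y <-> exists2 x, P x & y = h x) -> counted Q wt' f.
Proof.
case=> L Lf inj_h wt_h Q_h; exists (fun n => [seq h x | x <- L n]) => n.
have [uL mL ->] := Lf n; split; last by rewrite size_map.
  rewrite map_inj_in_uniq // => x y /mL[Px _] /mL[Py _]; exact: inj_h.
move=> y; split=> [/mapP[x /mL[Px <-] ->]|[/Q_h[x Px ->]]].
  by rewrite wt_h //; split=> //; apply/Q_h; exists x.
by rewrite wt_h // => wt_x; apply: map_f; apply/mL.
Qed.

Lemma counted_option (T : eqType) (P : T -> Prop) wt f : counted P wt f ->
  counted (fun o => if o is Some x then P x else True)
    (fun o => if o is Some x then (wt x).+1 else 0%N)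
    (fps_option f).
Proof.
case=> L Lf; exists (fun n => if n is n'.+1 then map Some (L n') else [:: None]).
case=> [|n]; first by split=> // -[x|] //=; split=> // -[].
have [uL mL eq_f] := Lf n; split; last by rewrite size_map -eq_f.
  by rewrite map_inj_uniq // => x y [].
case=> [x|]; last by split=> [/mapP[]|[]].
rewrite mem_map; last by move=> ? ? [].
by split=> [/mL[Px <-]|[Px [wt_x]]] //; apply/mL.
Qed.

Lemma counted_sum (T U : eqType) (P : T -> Prop) (Q : U -> Prop) wt wt' f g :
  counted P wt f -> counted Q wt' g ->
  counted (fun z => match z with inl x => P x | inr y => Q y end)
    (fun z => match z with inl x => wt x | inr y => wt' y end)
    (fps_add f g).
Proof.
case=> L Lf [M Mg]; exists (fun n => map inl (L n) ++ map inr (M n)) => n.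
rewrite /fps_add; have [uL mL ->] := Lf n; have [uM mM ->] := Mg n; split.
- rewrite cat_uniq !map_inj_uniq ?uL ?uM ?andbT //=; try by move=> ? ? [].
  by apply/hasPn => _ /mapP[y _ ->]; apply/mapP => -[].
- case=> z; rewrite mem_cat; split.
  + by case/orP=> /mapP[x] // /mL + [->].
  + by move=> /mL z_L; rewrite map_f.
  + by case/orP=> /mapP[x] // /mM + [->].
  + by move=> /mM z_M; rewrite [X in _ || X]map_f ?orbT.
by rewrite size_cat !size_map natrD.
Qed.

Lemma counted_prod (T U : eqType) (P : T -> Prop) (Q : U -> Prop) wt wt' f g :
  counted P wt f -> counted Q wt' g ->
  counted (fun z => P z.1 /\ Q z.2) (fun z => (wt z.1 + wt' z.2)%N) (fps_mul f g).
Proof.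
case=> L Lf [M Mg].
(* The index [i] is the weight of the first component. *)
exists (fun n => [seq z | i <- iota 0 n.+1, z <- [seq (x, y) | x <- L i, y <- M (n - i)%N]]).
move=> n; split.
- apply: allpairs_uniq_dep; first exact: iota_uniq.
    move=> i _; have [uL _ _] := Lf i; have [uM _ _] := Mg (n - i)%N.
    by apply: allpairs_uniq => // -[? ?] [? ?].
  move=> _ _ /allpairsPdep[i [z [_ z_i ->]]] /allpairsPdep[j [z' [_ z_j ->]]] /= zz'.
  subst z'; suff ij : i = j by subst j.
  case/allpairsP: z_i => -[x y] /= [x_i _ def_z].
  case/allpairsP: z_j => -[x' y'] /= [x_j _]; rewrite def_z => -[xx' _].
  have [_ mL _] := Lf i; have [_ mL' _] := Lf j.
  by case: (mL x) => /(_ x_i)[_ <-] _; case: (mL' x') => /(_ x_j)[_ <-] _; rewrite xx'.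
- case=> x y; split.
    case/allpairsPdep=> i [z [i_n + ->]] => /allpairsP[[x' y'] /= [x_i y_i ->]] /=.
    have [_ mL _] := Lf i; have [_ mM _] := Mg (n - i)%N.
    have [Px wx] := (mL x').1 x_i; have [Qy wy] := (mM y').1 y_i.
    by split=> //; move: i_n; rewrite mem_iota; lia.
  case=> -[Px Qy] wxy; rewrite /= in Px Qy wxy.
  apply/allpairsPdep; exists (wt x), (x, y); split=> //; first by rewrite mem_iota; lia.
  have [_ mL _] := Lf (wt x); have [_ mM _] := Mg (n - wt x)%N.
  by apply/allpairsP; exists (x, y); split=> //; [apply/mL | apply/mM; split=> //=; lia].
rewrite size_allpairs_dep sumnE big_map natr_sum /fps_mul -(big_mkord xpredT (fun i => f i * g (n - i)%N)).
rewrite /index_iota subn0; apply: eq_bigr => i _.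
by rewrite size_allpairs natrM; have [_ _ ->] := Lf i; have [_ _ ->] := Mg (n - i)%N.
Qed.

Lemma counted_nat : counted (fun _ : nat => True) id (fun=> 1).
Proof.
exists (fun n => [:: n]) => n; split=> // x; rewrite inE.
by split=> [/eqP|[_ ->]].
Qed.

Lemma counted_seq_bool : counted (fun _ : seq bool => True) size (fun n => 2 ^+ n).
Proof.
exists (fun n => [seq tval t | t <- enum {: n.-tuple bool}]) => n; split.
- by rewrite map_inj_uniq ?enum_uniq //; apply: val_inj.
- move=> b; split=> [/mapP[t _ ->]|[_ /eqP size_b]]; first by rewrite size_tuple.
  by apply/mapP; exists (Tuple size_b); rewrite ?mem_enum.
by rewrite size_map -cardE card_tuple card_bool natrX.
Qed.

Lemma counted_pos (T : eqType) (P : T -> Prop) wt f : counted P wt f ->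
  counted (fun x => P x /\ wt x <> 0%N) wt (fps_pos f).
Proof.
case=> L Lf; exists (fun n => if n == 0%N then [::] else L n) => n.
rewrite /fps_pos; have [uL mL ->] := Lf n; case: eqVneq => [->|/eqP n0]; first by split=> // x; split=> // -[[]].
split=> // x; split=> [/mL[Px wt_x]|[[Px _] wt_x]]; last exact/mL.
by rewrite wt_x.
Qed.

End Counting.

(** * From pattern containment to inequalities *)

Lemma order_iso4 (a b c d p q r s : nat) :

  order_iso [:: a; b; c; d] [:: p; q; r; s] =
  [&& (a < b) == (p < q), (a < c) == (p < r), (a < d) == (p < s),
      (b < c) == (q < r), (b < d) == (q < s), (c < d) == (r < s),
      (b < a) == (q < p), (c < a) == (r < p), (d < a) == (s < p),
      (c < b) == (r < q), (d < b) == (s < q) & (d < c) == (s < r)].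
Proof.
apply/idP/idP => [/andP[_ /forallP iso]|].
  have o (i j : 'I_4) := forallP (iso i) j.
  pose i0 := @Ordinal 4 0 isT; pose i1 := @Ordinal 4 1 isT.
  pose i2 := @Ordinal 4 2 isT; pose i3 := @Ordinal 4 3 isT.
  by rewrite (o i0 i1) (o i0 i2) (o i0 i3) (o i1 i2) (o i1 i3) (o i2 i3)
             (o i1 i0) (o i2 i0) (o i3 i0) (o i2 i1) (o i3 i1) (o i3 i2).
do 11 case/andP=> ?; move=> ?.
rewrite /order_iso eqxx /=; apply/forallP => -[[|[|[|[|i]]]] lt_i] //;
  by apply/forallP => -[[|[|[|[|j]]]] lt_j] //=; rewrite ?ltnn ?eqxx.
Qed.

Lemma order_iso3 (a b c p q r : nat) :
  order_iso [:: a; b; c] [:: p; q; r] =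
  [&& (a < b) == (p < q), (a < c) == (p < r), (b < c) == (q < r),
      (b < a) == (q < p), (c < a) == (r < p) & (c < b) == (r < q)].
Proof.
apply/idP/idP => [/andP[_ /forallP iso]|].
  have o (i j : 'I_3) := forallP (iso i) j.
  pose i0 := @Ordinal 3 0 isT; pose i1 := @Ordinal 3 1 isT; pose i2 := @Ordinal 3 2 isT.
  by rewrite (o i0 i1) (o i0 i2) (o i1 i2) (o i1 i0) (o i2 i0) (o i2 i1).
do 5 case/andP=> ?; move=> ?.
rewrite /order_iso eqxx /=; apply/forallP => -[[|[|[|i]]] lt_i] //;
  by apply/forallP => -[[|[|[|j]]] lt_j] //=; rewrite ?ltnn ?eqxx.
Qed.

Lemma avoids4P w (p q r s : nat) :
  ~~ contains [seq y.+1 | y <- w] [:: p; q; r; s] <->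
  forall a b c d, subseq [:: a; b; c; d] w ->
    ~~ order_iso [:: a.+1; b.+1; c.+1; d.+1] [:: p; q; r; s].
Proof.
split=> [ncont a b c d sub|av].
  apply: contra ncont => iso; apply/containsP.
  by exists [:: a.+1; b.+1; c.+1; d.+1] => //; apply: (map_subseq succn sub).
apply/containsP=> -[u /subseq_map_inv[v sub ->]].
case: v sub => [|a [|b [|c [|d [|e v]]]]] sub; try by case/andP.
exact/negP/av.
Qed.

Lemma avoids3P w (p q r : nat) :
  ~~ contains [seq y.+1 | y <- w] [:: p; q; r] <->
  forall a b c, subseq [:: a; b; c] w ->
    ~~ order_iso [:: a.+1; b.+1; c.+1] [:: p; q; r].
Proof.
split=> [ncont a b c sub|av].
  apply: contra ncont => iso; apply/containsP.
  by exists [:: a.+1; b.+1; c.+1] => //; apply: (map_subseq succn sub).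
apply/containsP=> -[u /subseq_map_inv[v sub ->]].
case: v sub => [|a [|b [|c [|d v]]]] sub; try by case/andP.
exact/negP/av.
Qed.

(** Words use the letters from 0 to n - 1; the successor map restores one-line notation. *)
Lemma counted_avoiders T :
  counted (fun w => perm_eq w (iota 0 (size w)) /\
             all (fun tau => ~~ contains [seq y.+1 | y <- w] tau) T)
    size (avoiders_gf T).
Proof.
pose word n (pi : 'S_n) := [seq val (pi i) | i <- enum 'I_n].
have one_lineE n (pi : 'S_n) : one_line pi = [seq y.+1 | y <- word n pi].
  by rewrite /one_line /word -map_comp.
have size_word n pi : size (word n pi) = n by rewrite size_map size_enum_ord.
have word_inj n : injective (word n).
  move=> pi rho eq_w; apply/permP => i; apply: val_inj.
  have := congr1 (nth 0 ^~ i) eq_w.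
  by rewrite !(nth_map i) -?enumT ?size_enum_ord // !nth_ord_enum.
exists (fun n => [seq word n pi | pi <- enum (avoiders n T)]) => n; split.
- by rewrite map_inj_uniq ?enum_uniq //; apply: word_inj.
- move=> w; split=> [/mapP[pi + ->]|[[perm_w av_w] size_w]].
    rewrite mem_enum inE one_lineE size_word => av_w; split=> //; split=> //.
    have uniq_w : uniq (word n pi).
      rewrite map_inj_uniq ?enum_uniq // => i j /val_inj; exact: perm_inj.
    apply: uniq_perm (iota_uniq _ _) _ => //.
    have sub : {subset word n pi <= iota 0 n}.
      by move=> _ /mapP[i _ ->]; rewrite mem_iota ltn_ord.
    by apply: (uniq_min_size uniq_w sub _).2; rewrite size_iota size_word.
  rewrite size_w in perm_w.
  have lt_w (i : 'I_n) : nth 0 w i < n.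
    by have := mem_nth 0 (_ : i < size w); rewrite size_w (perm_mem perm_w) mem_iota; apply.
  (* The permutation with word [w] sends each position to the letter found there. *)
  pose f i := Ordinal (lt_w i).
  have f_inj : injective f.
    move=> i j [/eqP]; rewrite nth_uniq ?size_w ?(perm_uniq perm_w) ?iota_uniq //.
    by move/eqP/val_inj.
  have def_w : w = word n (perm f_inj).
    apply: (@eq_from_nth _ 0) => [|i]; rewrite size_w ?size_word // => lt_i.
    rewrite (nth_map (Ordinal lt_i)) -?enumT ?size_enum_ord // permE /=.
    by rewrite -[i]/(val (Ordinal lt_i)) nth_ord_enum.
  by apply/mapP; exists (perm f_inj); rewrite ?mem_enum ?inE ?one_lineE -?def_w.
by rewrite size_map -cardE.
Qed.

Definition patternsF := [:: [:: 2; 4; 1; 3]; [:: 2; 4; 3; 1]; [:: 3; 2; 1; 4]].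
Definition patternsA := [:: [:: 3; 2; 1]; [:: 2; 4; 1; 3]].

Lemma counted_ext (T : eqType) (P Q : T -> Prop) wt f :
  (forall x, P x <-> Q x) -> counted P wt f -> counted Q wt f.
Proof.
move=> PQ cP; apply: (counted_image (h := id) cP) => // y.
by split=> [/PQ Py|[x /PQ Qx ->]] //; exists y.
Qed.

Lemma counted_permF : counted permF size (avoiders_gf patternsF).
Proof.
apply: counted_ext (counted_avoiders _) => w; rewrite /permF /= andbT.
split=> [[-> /and3P[/avoids4P av1 /avoids4P av2 /avoids4P av3]]|[-> [av1 av2 av3]]].
  split=> //; split=> a b c d sub.
  - by have := av1 _ _ _ _ sub; rewrite order_iso4 //; lia.
  - by have := av2 _ _ _ _ sub; rewrite order_iso4 //; lia.
  - by have := av3 _ _ _ _ sub; rewrite order_iso4 //; lia.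
split=> //; apply/and3P; split; apply/avoids4P => a b c d sub; rewrite order_iso4 //.
- by have := av1 _ _ _ _ sub; lia.
- by have := av2 _ _ _ _ sub; lia.
- by have := av3 _ _ _ _ sub; lia.
Qed.

Lemma counted_permA : counted permA size (avoiders_gf patternsA).
Proof.
apply: counted_ext (counted_avoiders _) => w; rewrite /permA /= andbT.
split=> [[-> /andP[/avoids3P av1 /avoids4P av2]]|[-> [av1 av2]]].
  split=> //; split=> [a b c sub|a b c d sub].
  - by have := av1 _ _ _ sub; rewrite order_iso3 //; lia.
  - by have := av2 _ _ _ _ sub; rewrite order_iso4 //; lia.
split=> //; apply/andP; split.
- by apply/avoids3P => a b c sub; have := av1 _ _ _ sub; rewrite order_iso3; lia.
- by apply/avoids4P => a b c d sub; have := av2 _ _ _ _ sub; rewrite order_iso4; lia.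
Qed.

(** * Functional equations of the generating functions *)

Local Open Scope ring_scope.

Definition bits_gf : fps rat := fun n => 2 ^+ n.
Definition nat_gf : fps rat := fun=> 1.
(** The series E. The outer factor x is the leading high letter of the shuffle, the inner one the
    first letter of block [s]. *)
Definition interleaving_gf : fps rat :=
  fps_option (fps_mul bits_gf (fps_option (fps_mul nat_gf nat_gf))).

Lemma counted_interleaving :
  counted (fun _ : interleaving => True) rank interleaving_gf.
Proof.
apply: (counted_image (h := id)
  (counted_option (counted_prod counted_seq_bool
    (counted_option (counted_prod counted_nat counted_nat))))) => //.
  by case=> [[b [[s t]|]]|].
by move=> e; split=> // _; exists e => //; case: e => [[b [[s t]|]]|].
Qed.

(** The map [h] is onto by [permF_split] and injective by [buildE_inj] and [buildE_rcons]; the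
    factor x of the outer [fps_option] is the largest letter. *)
Lemma avoidersF_gf : avoiders_gf patternsF =1
  fps_option (fps_add (avoiders_gf patternsA)
    (fps_mul (fps_mul (avoiders_gf patternsA) interleaving_gf)
             (fps_pos (avoiders_gf patternsF)))).
Proof.
apply: counted_unique counted_permF _.
pose h (o : option (seq nat + (seq nat * interleaving) * seq nat)) : seq nat :=
  match o with
  | None => [::]
  | Some (inl sigma) => rcons sigma (size sigma)
  | Some (inr (sigma, e, beta)) => buildE sigma e beta
  end.
apply: (counted_image (h := h) (counted_option (counted_sum counted_permA
  (counted_prod (counted_prod counted_permA counted_interleaving)
     (counted_pos counted_permF))))).
- have nz (s : seq nat) : size s <> 0%N -> s <> [::] by case: s.
  case=> [[s|[[s e] u]]|] [[s'|[[s' e'] u']]|] //=.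
  + by move=> _ _ /rcons_inj[->].
  + by move=> pA [[pA' _] [_ /nz u_nz]] /esym /buildE_rcons [].
  + by case: s.
  + by move=> [[pA _] [_ /nz u_nz]] pA' /buildE_rcons [].
  + by move=> [[pA _] [pF /nz u_nz]] [[pA' _] [pF' _]] /buildE_inj [] // -> -> ->.
  + by move=> _ _ /(congr1 size); rewrite size_buildE.
  + by case: s'.
  + by move=> _ _ /(congr1 size); rewrite size_buildE.
- by case=> [[s|[[s e] u]]|] //= _; rewrite ?size_rcons ?size_buildE.
move=> w; split=> [pF|[[[s|[[s e] u]]|] /= + ->]].
- case: (eqVneq w [::]) => [->|/eqP w_nz]; first by exists None.
  have [[s pA ->]|[s [e [u [pA pF' u_nz ->]]]]] := permF_split pF w_nz.
    by exists (Some (inl s)).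
  by exists (Some (inr (s, e, u))) => //=; split=> //; split=> //; case: (u) u_nz.
- by move/permF_rcons.
- by case=> -[pA _] [pF _]; apply: permF_buildE.
by split=> //; split=> a b c d /size_subseq.
Qed.

(** Here [beta] is increasing, so its positive length [m] represents it. *)
Lemma avoidersA_gf : avoiders_gf patternsA =1
  fps_option (fps_add (avoiders_gf patternsA)
    (fps_mul (fps_mul (avoiders_gf patternsA) (fps_option bits_gf))
             (fps_pos nat_gf))).
Proof.
apply: counted_unique counted_permA _.
pose h (o : option (seq nat + (seq nat * option (seq bool)) * nat)) : seq nat :=
  match o with
  | None => [::]
  | Some (inl sigma) => rcons sigma (size sigma)
  | Some (inr (sigma, b, m)) => buildE sigma (liftE b) (iota 0 m)
  end.
have permF_iota m : permF (iota 0 m).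
  by split; [rewrite size_iota | apply/avA_avF/avA_sorted/pairwise_ltn_iota].
have nz m : id m <> 0%N -> iota 0 m <> [::] by case: m.
have liftE_inj : injective liftE by case=> [b|] [b'|] //= [->].
apply: (counted_image (h := h) (counted_option (counted_sum counted_permA
  (counted_prod (counted_prod counted_permA (counted_option counted_seq_bool))
     (counted_pos counted_nat))))).
- case=> [[s|[[s e] u]]|] [[s'|[[s' e'] u']]|] //=.
  + by move=> _ _ /rcons_inj[->].
  + by move=> pA [[pA' _] [_ /nz u_nz]] /esym /buildE_rcons [].
  + by case: s.
  + by move=> [[pA _] [_ /nz u_nz]] pA' /buildE_rcons [].
  + move=> [[pA _] [_ /nz u_nz]] [[pA' _] _] /buildE_inj [] // -> /liftE_inj ->.
    by move/(congr1 size); rewrite !size_iota => ->.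
  + by move=> _ _ /(congr1 size); rewrite size_buildE.
  + by case: s'.
  + by move=> _ _ /(congr1 size); rewrite size_buildE.
- case=> [[s|[[s e] u]]|] //= _; rewrite ?size_rcons ?size_buildE ?size_iota //.
  by case: e => //= b; rewrite addn0.
move=> w; split=> [pA|[[[s|[[s e] u]]|] /= + ->]].
- case: (eqVneq w [::]) => [->|/eqP w_nz]; first by exists None.
  have [[s pA' ->]|[s [b [m [pA' ->]]]]] := permA_split pA w_nz.
    by exists (Some (inl s)).
  by exists (Some (inr (s, b, m.+1))) => //=; split=> //; split=> //; case: (b).
- exact: permA_rcons.
- by case=> -[pA _] _; apply: permA_buildE.
by split=> //; split=> [a b c|a b c d] /size_subseq.
Qed.

(** * Elimination of A, modulo an element [m] *)

Lemma gf_elimination (R : comNzRingType) (x m a b o f ra rb ro rf : R) :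
  b = 1 + x * (b + b) + rb * m -> o = 1 + x * o + ro * m ->
  a = 1 + x * (a + a * (1 + x * b) * (x * o)) + ra * m ->
  f = 1 + x * (a + a * (1 + x * (b * (1 + x * (o * o)))) * (f - 1)) + rf * m ->
  exists r, f * (1 - 6 * x + 11 * x ^+ 2 - 9 * x ^+ 3 + 2 * x ^+ 4) =
    1 - 5 * x + 7 * x ^+ 2 - 4 * x ^+ 3 + r * m.
Proof.
move=> Hb Ho Ha Hf.
(* Modulo [m], [b] and [o] are the inverses of [K1] and [K2], E is [W / (K1 * K2 ^+ 2)], and A will
   be [K1 / Q]. Division is replaced by multiplication by [b] or [o], with every multiple of [m]
   written out. *)
pose K1 := 1 - 2 * x; pose K2 := 1 - x; pose Q := 1 - 3 * x + x ^+ 2.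
pose W := K1 * K2 ^+ 2 + x * (K2 ^+ 2 + x).
have Eb : rb * m = b * K1 - 1.
  by transitivity (b - (1 + x * (b + b))); [rewrite {1}Hb; ring | rewrite /K1; ring].
have Eo : ro * m = o * K2 - 1.
  by transitivity (o - (1 + x * o)); [rewrite {1}Ho; ring | rewrite /K2; ring].
have Ea : ra * m = a - (1 + x * (a + a * (1 + x * b) * (x * o))) by rewrite {1}Ha; ring.
have Ef : rf * m = f - (1 + x * (a + a * (1 + x * (b * (1 + x * (o * o)))) * (f - 1))).
  by rewrite {1}Hf; ring.
(* The equation for [a] times [K1 * K2]; the factor [K2] appears because [K1 + x = K2]. *)
have [r1 E1] : exists r, r * m = K2 * (a * Q - K1).
  exists (K1 * K2 * ra + x ^+ 2 * a * (x * rb + (K1 + x * b * K1) * ro)).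
  transitivity (K1 * K2 * (ra * m) +
      x ^+ 2 * a * (x * (rb * m) + (K1 + x * b * K1) * (ro * m))); first by ring.
  by rewrite Ea Eb Eo /Q /K1 /K2; ring.
(* Multiplication by [o] cancels [K2]. *)
have [r2 E2] : exists r, r * m = a * Q - K1.
  exists (o * r1 - ro * (a * Q - K1)).
  transitivity (o * (r1 * m) - (ro * m) * (a * Q - K1)); first by ring.
  by rewrite E1 Eo; ring.
(* The equation for [f] times [K1 * K2 ^+ 2]. *)
have [r3 E3] : exists r, r * m =
    (f - 1) * K1 * K2 ^+ 2 - x * a * K1 * K2 ^+ 2 - x * a * (f - 1) * W.
  exists (K1 * K2 ^+ 2 * rf + x ^+ 2 * a * (f - 1) *
            (rb * (K2 ^+ 2 + x * (o * K2) ^+ 2) + x * ro * (o * K2 + 1))).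
  transitivity (K1 * K2 ^+ 2 * (rf * m) + x ^+ 2 * a * (f - 1) *
      ((rb * m) * (K2 ^+ 2 + x * (o * K2) ^+ 2) + x * (ro * m) * (o * K2 + 1))).
    by ring.
  by rewrite Ef Eb Eo /W; ring.
pose E := (f - 1) * (K2 ^+ 2 * Q - x * W) - x * K1 * K2 ^+ 2.
(* After multiplication by [Q], each [a * Q] is replaced by [K1]. *)
have [r4 E4] : exists r, r * m = K1 * E.
  exists (Q * r3 + (x * K1 * K2 ^+ 2 + x * (f - 1) * W) * r2).
  transitivity (Q * (r3 * m) + (x * K1 * K2 ^+ 2 + x * (f - 1) * W) * (r2 * m)).
    by ring.
  by rewrite E3 E2 /E; ring.
(* Multiplication by [b] cancels [K1]; in [E] the coefficient of [f - 1] is already the final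
   denominator. *)
exists (b * r4 - rb * E).
have -> : (b * r4 - rb * E) * m = b * (r4 * m) - (rb * m) * E by ring.
by rewrite E4 Eb /E /W /Q /K1 /K2; ring.
Qed.

(* Congruence of polynomials modulo ['X^N], i.e. of series up to order [N]. *)
Definition eqX N (p q : {poly rat}) := take_poly N p = take_poly N q.

Lemma eqX_coef N p q : eqX N p q <-> forall i, (i < N)%N -> p`_i = q`_i.
Proof.
split=> [pq i iN | pq].
  by have := congr1 (coefp i) pq; rewrite /= !coef_take_poly iN.
by apply/polyP => i; rewrite !coef_take_poly; case: ifP => // /pq.
Qed.

Lemma eqXP N p q : eqX N p q -> exists r, p = q + r * 'X^N.
Proof.
move=> pq; exists (drop_poly N p - drop_poly N q).
by rewrite -{1}(poly_take_drop N p) -{1}(poly_take_drop N q) pq; ring.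
Qed.

Lemma eqX_add N p q p' q' : eqX N p q -> eqX N p' q' -> eqX N (p + p') (q + q').
Proof.
move=> /eqX_coef pq /eqX_coef pq'; apply/eqX_coef => i iN.
by rewrite !coefD pq ?pq'.
Qed.

Lemma eqX_mul N p q p' q' : eqX N p q -> eqX N p' q' -> eqX N (p * p') (q * q').
Proof.
move=> /eqX_coef pq /eqX_coef pq'; apply/eqX_coef => i iN.
rewrite !coefM; apply: eq_bigr => j _.
by rewrite pq ?pq' //; have := ltn_ord j; lia.
Qed.

Lemma eqX_trans N p q r : eqX N p q -> eqX N q r -> eqX N p r.
Proof. exact: etrans. Qed.

(** Truncation moves the equations into a polynomial ring, where [gf_elimination] applies with [m] a
    power of the variable. *)
Definition trunc N (f : fps rat) : {poly rat} := \poly_(i < N) f i.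

Lemma trunc_mul N f g : eqX N (trunc N (fps_mul f g)) (trunc N f * trunc N g).
Proof.
apply/eqX_coef => i iN; rewrite coef_poly iN coefM /fps_mul; apply: eq_bigr => j _.
by rewrite !coef_poly !ifT //; have := ltn_ord j; lia.
Qed.

Lemma trunc_add N f g : eqX N (trunc N (fps_add f g)) (trunc N f + trunc N g).
Proof. by apply/eqX_coef => i iN; rewrite coefD !coef_poly iN. Qed.

Lemma trunc_option N f : eqX N (trunc N (fps_option f)) (1 + 'X * trunc N f).
Proof.
apply/eqX_coef => -[|i] iN; rewrite coefD coefXM coef1 !coef_poly iN ?addr0 //=.
by rewrite (ltnW iN) add0r.
Qed.

Lemma trunc_pos N f : f 0%N = 1 -> eqX N (trunc N (fps_pos f)) (trunc N f - 1).
Proof.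
move=> f0; apply/eqX_coef => -[|i] iN; rewrite coefB coef1 !coef_poly iN /fps_pos /= ?f0 ?subrr //.
by rewrite subr0.
Qed.

Lemma trunc_eq N f g : f =1 g -> eqX N (trunc N f) (trunc N g).
Proof. by move=> fg; apply/eqX_coef => i iN; rewrite !coef_poly iN fg. Qed.

Lemma trunc_bits N : eqX N (trunc N bits_gf) (1 + 'X * (trunc N bits_gf + trunc N bits_gf)).
Proof.
have bits_rec : bits_gf =1 fps_option (fps_add bits_gf bits_gf).
  by case=> [|n]; rewrite /bits_gf ?expr0 //= /fps_add exprS mulr_natl mulr2n.
apply: eqX_trans (trunc_eq N bits_rec) _; apply: eqX_trans (trunc_option _ _) _.
by apply: eqX_add => //; apply: eqX_mul => //; apply: trunc_add.
Qed.

Lemma trunc_nat N : eqX N (trunc N nat_gf) (1 + 'X * trunc N nat_gf).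
Proof.
have nat_rec : nat_gf =1 fps_option nat_gf by case.
exact: eqX_trans (trunc_eq N nat_rec) (trunc_option _ _).
Qed.

Lemma trunc_pos_nat N : eqX N (trunc N (fps_pos nat_gf)) ('X * trunc N nat_gf).
Proof. by apply/eqX_coef => -[|i] iN; rewrite coefXM !coef_poly iN //= (ltnW iN). Qed.

Lemma trunc_interleaving N : eqX N (trunc N interleaving_gf)
  (1 + 'X * (trunc N bits_gf * (1 + 'X * (trunc N nat_gf * trunc N nat_gf)))).
Proof.
rewrite /interleaving_gf.
apply: eqX_trans (trunc_option _ _) _; apply: eqX_add => //; apply: eqX_mul => //.
apply: eqX_trans (trunc_mul _ _ _) _; apply: eqX_mul => //.
apply: eqX_trans (trunc_option _ _) _; apply: eqX_add => //; apply: eqX_mul => //.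
exact: trunc_mul.
Qed.

Lemma trunc_avoidersA N : let a := trunc N (avoiders_gf patternsA) in
  eqX N a (1 + 'X * (a + a * (1 + 'X * trunc N bits_gf) * ('X * trunc N nat_gf))).
Proof.
move=> a; apply: eqX_trans (trunc_eq N avoidersA_gf) _.
apply: eqX_trans (trunc_option _ _) _; apply: eqX_add => //; apply: eqX_mul => //.
apply: eqX_trans (trunc_add _ _ _) _; apply: eqX_add => //.
apply: eqX_trans (trunc_mul _ _ _) _; apply: eqX_mul (trunc_pos_nat _).
by apply: eqX_trans (trunc_mul _ _ _) _; apply: eqX_mul => //; apply: trunc_option.
Qed.

Lemma trunc_avoidersF N :
  let a := trunc N (avoiders_gf patternsA) in
  let f := trunc N (avoiders_gf patternsF) in
  eqX N f (1 + 'X * (a + a * (1 + 'X * (trunc N bits_gf *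
    (1 + 'X * (trunc N nat_gf * trunc N nat_gf)))) * (f - 1))).
Proof.
move=> a f; apply: eqX_trans (trunc_eq N avoidersF_gf) _.
apply: eqX_trans (trunc_option _ _) _; apply: eqX_add => //; apply: eqX_mul => //.
apply: eqX_trans (trunc_add _ _ _) _; apply: eqX_add => //.
apply: eqX_trans (trunc_mul _ _ _) _.
apply: eqX_mul; last by apply: trunc_pos; rewrite avoidersF_gf.
by apply: eqX_trans (trunc_mul _ _ _) _; apply: eqX_mul => //; apply: trunc_interleaving.
Qed.

Theorem theorem27 :
  avoiders_gf [:: [:: 2; 4; 1; 3]%N; [:: 2; 4; 3; 1]%N; [:: 3; 2; 1; 4]%N]
  =1 fps_div
       (fps_of_poly (1 - 5 * 'X + 7 * 'X^2 - 4 * 'X^3 : {poly rat}))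
       (fps_of_poly (1 - 6 * 'X + 11 * 'X^2 - 9 * 'X^3 + 2 * 'X^4 : {poly rat})).
Proof.
apply/fps_divP.
  rewrite /fps_of_poly !mulr_natl !(coefD, coefN, coefMn, coefXn, coefX) coef1.
  by rewrite ?mul0rn ?mulr0n ?(subr0, addr0) unitr1.
(* The coefficient of index [n] is determined modulo ['X^n.+1]. *)
move=> n; have [rb Hb] := eqXP (@trunc_bits n.+1).
have [ro Ho] := eqXP (@trunc_nat n.+1).
have [ra Ha] := eqXP (@trunc_avoidersA n.+1).
have [rf Hf] := eqXP (@trunc_avoidersF n.+1).
have [r /(congr1 (coefp n))] := gf_elimination Hb Ho Ha Hf.
(* The multiple of ['X^n.+1] contributes nothing to this coefficient. *)
rewrite /= coefD coefMXn ltnS leqnn addr0; apply: etrans.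
by rewrite coefM; apply: eq_bigr => i _; rewrite coef_poly ltn_ord.
Qed.
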